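(* Let $V\subset L$ be a primitive isotropic sublattice of rank two, and let $\mathcal V^+\subset\Omega^+$ be the open subset $$\mathcal V^+=\Big\{[\omega]\in\Omega^+\ \Big|\ \widetilde u_2([\omega])>\max\Big(\rho(\tau([\omega])),\ \tfrac{2}{\sqrt3}\Big)\Big\}.$$ Then: (a) $\mathcal V^+$ is left invariant by the action of $P^+$; (b) $U(N)_{\mathbb Z}\backslash\mathcal V^+$ is an open subset of the total space of the holomorphic principal $\mathbb T$-bundle $$U(N)_{\mathbb Z}\backslash\Omega^+(V)\ \longrightarrow\ U(N)_{\mathbb C}\backslash\Omega^+(V),$$ and its intersection with every fiber of this bundle is an open (punctured) neighborhood of the cusp; (c) for any two $[\omega_1],[\omega_2]\in\mathcal V^+$ and any $\gamma\in\Gamma^+$ such that $\gamma([\omega_1])=[\omega_2]$, one has $\gamma\in P^+$.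
   Context: Lattices. $L=H\oplus H\oplus E_8\oplus E_8$ is the even unimodular lattice of signature $(2,18)$ ($H$ the rank-two hyperbolic lattice, $E_8$ negative definite), with pairing $\langle\cdot,\cdot\rangle$ extended $\mathbb C$-bilinearly. The period domain is $\Omega=\{[\omega]\in\mathbb P(L\otimes\mathbb C)\mid\langle\omega,\omega\rangle=0,\ \langle\omega,\bar\omega\rangle>0\}$; it has two connected components interchanged by complex conjugation, and $\Omega^+$ is one of them, fixed. $\Gamma$ is the group of integral isometries of $L$, $\Gamma^+\subset\Gamma$ the index-two subgroup preserving $\Omega^+$, $P\subset\Gamma$ the subgroup of isometries stabilizing $V$, and $P^+=P\cap\Gamma^+$. The functions $\tau$, $\widetilde u_2$, $\rho$. For $[\omega]\in\Omega$ one has $\langle\omega,y\rangle\neq0$ for every nonzero $y\in V$, and $\langle\omega,\cdot\rangle:V\otimes\mathbb R\to\mathbb C$ is an isomorphism of real vector spaces. Choose a $\mathbb Z$-basis $\{y_1,y_2\}$ of $V$ such that $$\tau([\omega])=\frac{\langle\omega,y_1\rangle}{\langle\omega,y_2\rangle}$$ has positive imaginary part, and set $$\widetilde u_2([\omega])=\frac{\langle\omega,\bar\omega\rangle}{4\,|\langle\omega,y_2\rangle|^2\,\operatorname{Im}\tau([\omega])}.$$ $\tau$ is well defined up to the usual $SL(2,\mathbb Z)$-action on the upper half-plane $\mathbb H$, and $\widetilde u_2$ is well defined. The function $\rho:\mathbb H\to(0,\infty)$ is the $SL(2,\mathbb Z)$-invariant function $\rho(\tau)=\sup_{m\in SL(2,\mathbb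 Z)}\operatorname{Im}(m\cdot\tau)$. The bundle. Up to sign there is a unique primitive integral nilpotent endomorphism $N$ of $L$ in the Lie algebra of the orthogonal group (i.e. $\langle Nx,y\rangle+\langle x,Ny\rangle=0$) whose image is $V$; the sign is fixed by requiring $i\langle N\omega,\bar\omega\rangle>0$ for $[\omega]\in\Omega^+$. Put $U(N)_{\mathbb C}=\{\exp(zN)\mid z\in\mathbb C\}$, $U(N)_{\mathbb Z}=\{\exp(zN)\mid z\in\mathbb Z\}$; these act on the quadric $\Omega^\vee=\{[\omega]\in\mathbb P(L\otimes\mathbb C)\mid\langle\omega,\omega\rangle=0\}\supset\Omega$. Put $\Omega^+(V)=U(N)_{\mathbb C}\cdot\Omega^+$ and $\mathbb T=U(N)_{\mathbb Z}\backslash U(N)_{\mathbb C}\cong\mathbb C^*$ via $\exp(zN)\mapsto e^{2\pi i z}$. The projection in (b) is a holomorphic principal $\mathbb T$-bundle, and $U(N)_{\mathbb Z}\backslash\Omega^+$ is an open subset of its total space. The cusp of a fiber (a copy of $\mathbb C^*$) is the point $0$ added when $\mathbb C^*$ is completed to $\mathbb C$ in the associated line fibration (total space) $\times_{\mathbb T}\mathbb C$, i.e. the limit of $\exp(zN)\cdot[\omega]$ as $\operatorname{Im}z\to+\infty$; ''open neighborhood of the cusp'' means that the intersection together with this added point is an open neighborhood of it in $\mathbb C$. *)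

(* Defs.v *)
From HB Require Import structures.
From mathcomp Require Import all_boot all_order all_algebra.
From mathcomp Require Import generic_quotient.
From mathcomp Require Import all_classical all_reals all_analysis.
From mathcomp Require Import complex.

Set Implicit Arguments.
Unset Strict Implicit.
Unset Printing Implicit Defensive.
Import Order.TTheory GRing.Theory Num.Theory.
Import numFieldNormedType.Exports.
Local Open Scope classical_set_scope.
Local Open Scope ring_scope.
Local Open Scope complex_scope.
Local Open Scope quotient_scope.

(* MathComp-Analysis only equips abstract number fields with their norm
   topology; this transports it to the concrete field R[i]. *)
#[export, non_forgetful_inheritance]
HB.instance Definition _ (R : realType) := PseudoMetricNormedZmod.copy R[i] R[i]^o.

Definition H_gram : 'M[int]_2 := \matrix_(i, j) (i != j)%:R.

(* Edges of the E8 Dynkin diagram, Bourbaki labels shifted to start at 0. *)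
Definition E8_edges : seq (nat * nat) :=
  [:: (0, 2); (2, 3); (3, 4); (4, 5); (5, 6); (6, 7); (1, 3)]%N.

(* Negative definite: minus the Cartan matrix. *)
Definition E8_gram : 'M[int]_8 :=
  \matrix_(i, j)
    (if i == j then -2
     else (((val i, val j) \in E8_edges) ||
           ((val j, val i) \in E8_edges))%:R).

Definition L_gram : 'M[int]_20 :=
  block_mx (block_mx H_gram 0 0 H_gram) 0 0 (block_mx E8_gram 0 0 E8_gram)
    : 'M[int]_(2 + 2 + (8 + 8)).

Notation lattice := 'cV[int]_20.

Definition lat_form (x y : lattice) : int := (x^T *m L_gram *m y) 0 0.

Definition sublattice (V : set lattice) : Prop :=
  V 0 /\ (forall x y, V x -> V y -> V (x - y)).

Definition Zbasis (V : set lattice) (y : lattice * lattice) : Prop :=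
  V = [set a *: y.1 + b *: y.2 | a in [set: int] & b in [set: int]] /\
  (forall a b : int, a *: y.1 + b *: y.2 = 0 -> a = 0 /\ b = 0).

Definition primitive_isotropic_rank2 (V : set lattice) : Prop :=
  [/\ sublattice V,
      exists y, Zbasis V y,
      forall (k : int) (x : lattice), k != 0 -> V (k *: x) -> V x
    & forall x y, V x -> V y -> lat_form x y = 0].

Definition isometries : set 'M[int]_20 :=
  [set g | g \in unitmx /\
           forall x y, lat_form (g *m x) (g *m y) = lat_form x y].

Definition stabilizer (V : set lattice) : set 'M[int]_20 :=
  [set g | isometries g /\ [set g *m x | x in V] = V].

Section Period.
Variable R : realType.

Definition nonzero_vectors : set 'cV[R[i]]_20 := [set v | v != 0].

Definition collinear : rel nonzero_vectors :=
  fun u v => `[< exists2 c : R[i], c != 0 & \val u = c *: \val v >].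

Lemma collinear_refl : reflexive collinear.
Proof. by move=> u; apply/asboolP; exists 1; rewrite ?oner_neq0 ?scale1r. Qed.

Lemma collinear_imp u v : collinear u v -> collinear v u.
Proof.
move=> /asboolP[c c0 uv]; apply/asboolP; exists c^-1; first by rewrite invr_neq0.
by rewrite uv scalerA mulVf ?scale1r.
Qed.

Lemma collinear_sym : symmetric collinear.
Proof. by move=> u v; apply/idP/idP => /collinear_imp. Qed.

Lemma collinear_trans : transitive collinear.
Proof.
move=> v u w /asboolP[c c0 uv] /asboolP[d d0 vw]; apply/asboolP.
by exists (c * d); rewrite ?mulf_neq0 // uv vw scalerA.
Qed.

Canonical collinear_equiv :=
  EquivRel collinear collinear_refl collinear_sym collinear_trans.

Definition proj_space : topologicalType := quotient_topology {eq_quot collinear}.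

(* A vector spanning the line x; everything below is independent of it. *)
Definition spanning (x : proj_space) : 'cV[R[i]]_20 :=
  \val (repr (x : {eq_quot collinear})).

(* The action [w] |-> [g w], for invertible g (the point x itself is the
   junk value when g kills the line x). *)
Definition proj_act (g : 'M[R[i]]_20) (x : proj_space) : proj_space :=
  let w := repr (x : {eq_quot collinear}) in
  \pi_{eq_quot collinear} (insubd w (g *m \val w)).

Definition to_C m n (A : 'M[int]_(m, n)) : 'M[R[i]]_(m, n) :=
  map_mx intr A.

Definition lat_act (g : 'M[int]_20) : proj_space -> proj_space := proj_act (to_C g).

Definition C_form (u v : 'cV[R[i]]_20) : R[i] :=
  (u^T *m to_C L_gram *m v) 0 0.

Definition conj_vec (u : 'cV[R[i]]_20) : 'cV[R[i]]_20 := map_mx Num.conj u.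

(* In R[i], [0 < z] means that z is real and positive. *)
Definition Omega : set proj_space :=
  [set x | let w := spanning x in
           C_form w w = 0 /\ 0 < C_form w (conj_vec w)].

Definition is_component (T : topologicalType) (A B : set T) : Prop :=
  exists2 x, A x & B = connected_component A x.

Section Component.
Variable Omega_p : set proj_space.

Definition Gamma_p : set 'M[int]_20 :=
  [set g | isometries g /\ lat_act g @` Omega_p = Omega_p].

Definition P_p (V : set lattice) : set 'M[int]_20 := stabilizer V `&` Gamma_p.

End Component.

Definition period (x : proj_space) (y : lattice) : R[i] :=
  C_form (spanning x) (to_C y).

Definition period_ratio (x : proj_space) (y : lattice * lattice) : R[i] :=
  period x y.1 / period x y.2.

(* A choice of a Z-basis of V for which the ratio of periods has positive
   imaginary part. *)
Definition period_basis (V : set lattice) (x : proj_space) : lattice * lattice :=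
  xget (0, 0) [set y | Zbasis V y /\ 0 < complex.Im (period_ratio x y)].

Definition tau (V : set lattice) (x : proj_space) : R[i] :=
  period_ratio x (period_basis V x).

(* The quotient is a real number; Re turns it into an element of R. *)
Definition u2 (V : set lattice) (x : proj_space) : R :=
  let w := spanning x in
  complex.Re (C_form w (conj_vec w) /
    (4 * `|period x (period_basis V x).2| ^+ 2 * (complex.Im (tau V x))%:C)).

Definition SL2Z : set 'M[int]_2 := [set m | \det m = 1].

Definition mobius (m : 'M[int]_2) (t : R[i]) : R[i] :=
  ((m 0 0)%:~R * t + (m 0 1)%:~R) / ((m 1 0)%:~R * t + (m 1 1)%:~R).

Definition rho (t : R[i]) : R := sup [set complex.Im (mobius m t) | m in SL2Z].

Definition calV_p (Omega_p : set proj_space) (V : set lattice) : set proj_space :=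
  [set x | Omega_p x /\ Num.max (rho (tau V x)) (2 / Num.sqrt 3) < u2 V x].

Definition primitive_endo (N : 'M[int]_20) : Prop :=
  forall (k : int) (M : 'M[int]_20), N = k *: M -> k \is a GRing.unit.

Definition is_N (Omega_p : set proj_space) (V : set lattice) (N : 'M[int]_20) :
    Prop :=
  [/\ primitive_endo N,
      exists k, N ^+ k = 0,
      forall x y, lat_form (N *m x) y + lat_form x (N *m y) = 0,
      range (fun x : lattice => N *m x) = V
    & forall x, Omega_p x ->
        let w := spanning x in 0 < 'i * C_form (to_C N *m w) (conj_vec w)].

(* exp(zN): as N is a nilpotent 20 x 20 matrix, N ^+ 20 = 0. *)
Definition expN (N : 'M[int]_20) (z : R[i]) : 'M[R[i]]_20 :=
  \sum_(k < 20) (z ^+ k / k`!%:R) *: to_C N ^+ k.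

Definition UC (N : 'M[int]_20) : set 'M[R[i]]_20 := range (expN N).

Definition UZ (N : 'M[int]_20) : set 'M[R[i]]_20 :=
  range (fun n : int => expN N n%:~R).

Definition OmegaV (Omega_p : set proj_space) (N : 'M[int]_20) : set proj_space :=
  [set proj_act u x | u in UC N & x in Omega_p].

(* The quotient U \ D, for a group of matrices U acting on D, with the
   quotient of the subspace topology of D. *)
Section OrbitSpace.
Variables (U : set 'M[R[i]]_20) (D : set proj_space).

Definition mx_orbit (x : proj_space) : set proj_space :=
  [set proj_act u x | u in U].

Definition same_orbit : rel D :=
  fun x y => `[< mx_orbit (\val x) = mx_orbit (\val y) >].

Lemma same_orbit_refl : reflexive same_orbit.
Proof. by move=> x; apply/asboolP. Qed.

Lemma same_orbit_sym : symmetric same_orbit.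
Proof. by move=> x y; apply/asboolP/asboolP => ->. Qed.

Lemma same_orbit_trans : transitive same_orbit.
Proof. by move=> y x z /asboolP xy /asboolP yz; apply/asboolP; rewrite xy. Qed.

Canonical same_orbit_equiv :=
  EquivRel same_orbit same_orbit_refl same_orbit_sym same_orbit_trans.

Definition orbit_space : topologicalType :=
  quotient_topology {eq_quot same_orbit}.

Definition orbit_class (x : D) : orbit_space := \pi_{eq_quot same_orbit} x.

Definition orbit_repr (t : orbit_space) : D :=
  repr (t : {eq_quot same_orbit}).

Definition orbit_image (A : set proj_space) : set orbit_space :=
  [set orbit_class x | x in [set x : D | A (\val x)]].

End OrbitSpace.

Section Bundle.
Variables (Omega_p : set proj_space) (N : 'M[int]_20).

Definition total_space : topologicalType :=
  orbit_space (UZ N) (OmegaV Omega_p N).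

Definition base_space : topologicalType :=
  orbit_space (UC N) (OmegaV Omega_p N).

Definition bundle_proj (t : total_space) : base_space :=
  orbit_class (UC N) (orbit_repr t).

Definition fiber (b : base_space) : set total_space :=
  [set t | bundle_proj t = b].

(* The action of exp(zN) on the total space; OmegaV is stable under U(N)_C, so
   the default value of insubd is never used. *)
Definition bundle_act (z : R[i]) (t : total_space) : total_space :=
  let x := orbit_repr t in
  orbit_class (UZ N) (insubd x (proj_act (expN N z) (\val x))).

Definition cexp (z : R[i]) : R[i] :=
  (expR (complex.Re z))%:C * (cos (complex.Im z) +i* sin (complex.Im z)).

(* The coordinate of exp(zN) under U(N)_Z \ U(N)_C ~ C^*. *)
Definition torus_coord (z : R[i]) : R[i] := cexp (2 * pi%:C * 'i * z).

(* A point t of a fiber identifies C^* with this fiber, by s |-> s . t; it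
   extends to an identification of C with the fiber completed by its cusp,
   0 being sent to the cusp.  In this coordinate, the set below is the
   subset A of the fiber together with the cusp. *)
Definition with_cusp (t : total_space) (A : set total_space) : set R[i] :=
  [set s | s = 0 \/ exists2 z, s = torus_coord z & A (bundle_act z t)].

End Bundle.

End Period.

Arguments orbit_image {R} U D A _.

(* Main.v *)
Require Import Defs.
From HB Require Import structures.
From mathcomp Require Import all_boot all_order all_algebra.
From mathcomp Require Import generic_quotient.
From mathcomp Require Import all_classical all_reals all_analysis.
From mathcomp Require Import complex.
From mathcomp Require Import ring lra zify.

Set Implicit Arguments.
Unset Strict Implicit.
Unset Printing Implicit Defensive.
Import Order.TTheory GRing.Theory Num.Theory.
Import numFieldNormedType.Exports.
Local Open Scope classical_set_scope.
Local Open Scope ring_scope.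

(** A period vector [w] spans with its conjugate a positive definite real plane,
    whose orthogonal is negative definite since the signature is (2, 18)
    ([orth_plane_eq0]). So an isotropic vector is determined, as far as lengths
    go, by its period [<w, y>], and V embeds by its periods as a lattice in the
    complex plane. All the functions of the statement are read on this lattice
    and on [herm w = <w, conj w>]: with [area] the covolume of a basis of V,
    [u2] is [herm / (4 * area)] ([invariantsE]), and [rho] measures the shortest
    vector. Statement (a) follows, as isometries preserve all of this
    ([calV_p_act]).

    For (c), the orbit of [tau] under SL(2, Z) contains points of imaginary part
    arbitrarily close to [rho], which is at least [sqrt 3 / 2] ([mobius_Im_gt]).
    The conditions [u2 > rho] and [u2 > 2 / sqrt 3] then provide a basis of V
    with [1 / u2 < Im tau < u2] ([short_basis]), which says that the second
    vector, and the component of the first one orthogonal to it, have squared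
    period less than [herm / 4]. By Cauchy-Schwarz on the plane and on its
    orthogonal ([isotropic_bound]), two such isotropic vectors have pairing less
    than 1 in absolute value. If [g w1 = w2] with both points in the
    neighborhood, short bases of [g V] and of V at [w2] therefore pair to
    integers of absolute value less than 1, that is, to zero, first for the
    second vectors and then, after subtracting real multiples of these, for the
    others ([reduced_planes_orth]). A maximal isotropic subspace is its own
    orthogonal, so [g V] and V span the same real plane, and they coincide by
    primitivity ([stabilizer_of_short_points]).

    For (b), as N is skew and V isotropic, [N ^+ 2 = 0] ([N_sqr]), so that
    [exp (z N) w = w + z N w] has the same periods along V as [w], while [herm] increases by [2 * Im z] times the
    positive number [i <N w, conj w>] ([herm_expv]). In a fiber the neighborhood
    is thus a half-plane [Im z > K] ([calV_p_threshold]), which is a punctured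
    disc in the coordinate [exp (2 pi i z)]. Two topological facts complete the
    argument: points of the domain at which a basis of V has positive area lie
    in the same component, as shown by an explicit path ([same_component]), and
    [rho] is upper semicontinuous ([rho_usc]). The first one implies that the
    component is open in the domain and that fibers do not leave it, and with
    the second one the neighborhood is open ([calV_p_locally_open]). *)

(** * The lattice pairing over any ring *)

(** One definition over every ring, so that ring morphisms transport it: it is
    [lat_form] over the integers and [C_form] over the complex numbers. *)
Definition pairing (T : comNzRingType) (u v : 'cV[T]_20) : T :=
  (u^T *m map_mx intr L_gram *m v) 0 0.

Lemma C_formE (R : realType) (u v : 'cV[R[i]]_20) : C_form u v = pairing u v.
Proof. by []. Qed.

Lemma H_gram_sym : H_gram^T = H_gram.
Proof. by apply/matrixP => i j; rewrite !mxE eq_sym. Qed.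

Lemma E8_gram_sym : E8_gram^T = E8_gram.
Proof. by apply/matrixP => i j; rewrite !mxE eq_sym orbC. Qed.

Lemma L_gram_sym : L_gram^T = L_gram.
Proof.
rewrite /L_gram (@tr_block_mx _ (2 + 2) (8 + 8) (2 + 2) (8 + 8)).
by rewrite !trmx0 !tr_block_mx !trmx0 H_gram_sym E8_gram_sym.
Qed.

Section Form.
Variable T : comNzRingType.
Implicit Types (u v w : 'cV[T]_20) (a : T).

Lemma pairingC u v : pairing u v = pairing v u.
Proof.
rewrite /pairing; have tr00 (M : 'M[T]_1) : M 0 0 = M^T 0 0 by rewrite mxE.
rewrite [LHS]tr00.
rewrite !trmx_mul trmxK.

by rewrite  matrix.map_trmx L_gram_sym mulmxA.
Qed.

Lemma pairingDl u v w : pairing (u + v) w = pairing u w + pairing v w.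
Proof. by rewrite /pairing linearD /= !mulmxDl mxE. Qed.

Lemma pairingZl a u v : pairing (a *: u) v = a * pairing u v.
Proof. by rewrite /pairing linearZ /= -!scalemxAl mxE. Qed.

Lemma pairingDr u v w : pairing u (v + w) = pairing u v + pairing u w.
Proof. by rewrite pairingC pairingDl !(pairingC _ u). Qed.

Lemma pairingZr a u v : pairing u (a *: v) = a * pairing u v.
Proof. by rewrite pairingC pairingZl pairingC. Qed.

Lemma pairingNl u v : pairing (- u) v = - pairing u v.
Proof. by rewrite -scaleN1r pairingZl mulN1r. Qed.

Lemma pairingNr u v : pairing u (- v) = - pairing u v.
Proof. by rewrite pairingC pairingNl pairingC. Qed.

Lemma pairing0l u : pairing 0 u = 0.
Proof. by rewrite -(scale0r 0) pairingZl mul0r. Qed.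

Lemma pairing0r u : pairing u 0 = 0.
Proof. by rewrite pairingC pairing0l. Qed.

Definition pairingE := (pairingDl, pairingDr, pairingZl, pairingZr, pairingNl, pairingNr).

End Form.

Lemma map_pairing (T T' : comNzRingType) (f : {rmorphism T -> T'}) u v :
  f (pairing u v) = pairing (map_mx f u) (map_mx f v).
Proof.
rewrite /pairing matrix.map_trmx -[map_mx intr L_gram in RHS](_ : map_mx f (map_mx intr L_gram) = _).
  by rewrite -!map_mxM [RHS]mxE.
by apply/matrixP => i j; rewrite !mxE rmorph_int.
Qed.

Lemma lat_formE (T : comNzRingType) (x y : lattice) :
  (lat_form x y)%:~R = pairing (map_mx intr x) (map_mx intr y) :> T.
Proof.
by rewrite -map_pairing /pairing /lat_form (_ : map_mx intr L_gram = L_gram) //;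
   apply/matrixP => i j; rewrite !mxE intz.
Qed.

(** The quadratic form of minus [E8_gram], as a sum of squares: the coefficients
    come from eliminating the vertices of the Dynkin diagram one by one,
    starting from its leaves. Coordinates are indexed by natural numbers so
    that the expansion over the Dynkin diagram computes. *)
Definition E8_sq (T : fieldType) (x : nat -> T) : T :=
  2 * (x 0 - x 2 / 2) ^+ 2 + 2 * (x 1 - x 3 / 2) ^+ 2 +
  3 / 2 * (x 2 - 2 / 3 * x 3) ^+ 2 + 5 / 6 * (x 3 - 6 / 5 * x 4) ^+ 2 +
  4 / 5 * (x 4 - 5 / 4 * x 5) ^+ 2 + 3 / 4 * (x 5 - 4 / 3 * x 6) ^+ 2 +
  2 / 3 * (x 6 - 3 / 2 * x 7) ^+ 2 + 1 / 2 * x 7 ^+ 2.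

Definition E8_norm (T : fieldType) (x : 'cV[T]_8) : T := E8_sq (fun k => x (inord k) 0).

Lemma E8_gramE (T : realFieldType) (x : 'cV[T]_8) :
  (x^T *m map_mx intr E8_gram *m x) 0 0 = - E8_norm x.
Proof.
pose f k := x (inord k) 0; rewrite /E8_norm -/f.
have xE i : x i 0 = f i by rewrite /f inord_val.
rewrite mxE.
under eq_bigr => i _ do
  (rewrite mxE xE; under eq_bigr => j _ do rewrite !mxE xE).
rewrite !big_ord_recl !big_ord0 /= /bump /= ?mulr1z ?mulr0z /E8_sq.
by field.
Qed.

Lemma E8_sq_ge0 (T : realFieldType) (x : 'cV[T]_8) : 0 <= E8_norm x.
Proof.
pose f k := x (inord k) 0; rewrite /E8_norm -/f /E8_sq.
have sq (c z : T) : 0 <= c -> 0 <= c * z ^+ 2.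
  by move=> c0; rewrite mulr_ge0 ?sqr_ge0.
by rewrite !addr_ge0 // sq //; lra.
Qed.

Lemma E8_sq_eq0 (T : realFieldType) (x : 'cV[T]_8) : E8_norm x = 0 -> x = 0.
Proof.
pose f k := x (inord k) 0; rewrite /E8_norm -/f /E8_sq.
have xE i : x i 0 = f i by rewrite /f inord_val.
move=> e.
have sq (c z : T) : 0 < c -> 0 <= c * z ^+ 2.
  by move=> c0; rewrite mulr_ge0 ?sqr_ge0 // ltW.
have sq0 (c z : T) : 0 < c -> c * z ^+ 2 <= 0 -> z = 0.
  move=> c0; rewrite pmulr_rle0 // => z0; apply/eqP; rewrite -sqrf_eq0.
  by rewrite eq_le z0 sqr_ge0.
have s0 := @sq 2 (f 0%N - f 2 / 2) ltac:(lra).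
have s1 := @sq 2 (f 1%N - f 3 / 2) ltac:(lra).
have s2 := @sq (3 / 2) (f 2 - 2 / 3 * f 3) ltac:(lra).
have s3 := @sq (5 / 6) (f 3 - 6 / 5 * f 4) ltac:(lra).
have s4 := @sq (4 / 5) (f 4 - 5 / 4 * f 5) ltac:(lra).
have s5 := @sq (3 / 4) (f 5 - 4 / 3 * f 6) ltac:(lra).
have s6 := @sq (2 / 3) (f 6 - 3 / 2 * f 7) ltac:(lra).
have s7 := @sq (1 / 2) (f 7) ltac:(lra).
have e0 : f 0%N - f 2 / 2 = 0 by apply: (sq0 2); lra.
have e1 : f 1%N - f 3 / 2 = 0 by apply: (sq0 2); lra.
have e2 : f 2 - 2 / 3 * f 3 = 0 by apply: (sq0 (3 / 2)); lra.
have e3 : f 3 - 6 / 5 * f 4 = 0 by apply: (sq0 (5 / 6)); lra.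
have e4 : f 4 - 5 / 4 * f 5 = 0 by apply: (sq0 (4 / 5)); lra.
have e5 : f 5 - 4 / 3 * f 6 = 0 by apply: (sq0 (3 / 4)); lra.
have e6 : f 6 - 3 / 2 * f 7 = 0 by apply: (sq0 (2 / 3)); lra.
have e7 : f 7 = 0 by apply: (sq0 (1 / 2)); lra.
clear e s0 s1 s2 s3 s4 s5 s6 s7.
apply/colP => i; rewrite xE mxE.
by case: i => -[|[|[|[|[|[|[|[|//]]]]]]]] ? /=; lra.
Qed.

(** * The signature (2, 18) *)
(** In the coordinates of H + H + E8 + E8 the quadratic form is half the sum of
    the squares of these two, minus a positive definite form in the others, that
    is, its signature is (2, 18). *)
Definition plus1 (T : fieldType) (x : 'cV[T]_20) : T := x (inord 0) 0 + x (inord 1) 0.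
Definition plus2 (T : fieldType) (x : 'cV[T]_20) : T := x (inord 2) 0 + x (inord 3) 0.

Definition minus_sq (T : fieldType) (x : 'cV[T]_(2 + 2 + (8 + 8))) : T :=
  ((x (inord 0) 0 - x (inord 1) 0) ^+ 2 + (x (inord 2) 0 - x (inord 3) 0) ^+ 2) / 2
  + E8_norm (usubmx (dsubmx x)) + E8_norm (dsubmx (dsubmx x)).

Lemma H_gramE (T : comNzRingType) (x : 'cV[T]_2) :
  (x^T *m map_mx intr H_gram *m x) 0 0 = 2 * x 0 0 * x 1 0.
Proof.
rewrite mxE; under eq_bigr => i _ do
  (rewrite mxE; under eq_bigr => j _ do rewrite !mxE).
rewrite !big_ord_recl !big_ord0 /= [lift _ _](_ : _ = 1); last exact/val_inj.
by rewrite ?mulr0z ?mulr1z; ring.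
Qed.

Lemma quad_block (T : comNzRingType) m n (A : 'M[int]_m) (B : 'M[int]_n)
    (x : 'cV[T]_(m + n)) :
  (x^T *m map_mx intr (block_mx A 0 0 B) *m x) 0 0 =
  ((usubmx x)^T *m map_mx intr A *m usubmx x) 0 0 +
  ((dsubmx x)^T *m map_mx intr B *m dsubmx x) 0 0.
Proof.
rewrite -[x in LHS]vsubmxK map_block_mx !map_mx0 tr_col_mx.
by rewrite mul_row_block mul_row_col !mulmx0 addr0 add0r mxE.
Qed.

Lemma pairing_signature (T : realFieldType) (x : 'cV[T]_20) :
  pairing x x = (plus1 x ^+ 2 + plus2 x ^+ 2) / 2 - minus_sq x.
Proof.
rewrite /plus1 /plus2 /minus_sq.
pose X : 'cV[T]_(2 + 2 + (8 + 8)) := x.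
have x0 : x (inord 0) 0 = (usubmx (usubmx X)) 0 0.
  by rewrite !mxE; congr (x _ _); apply/val_inj; rewrite /= inordK.
have x1 : x (inord 1) 0 = (usubmx (usubmx X)) 1 0.
  by rewrite !mxE; congr (x _ _); apply/val_inj; rewrite /= inordK.
have x2 : x (inord 2) 0 = (dsubmx (usubmx X)) 0 0.
  by rewrite !mxE; congr (x _ _); apply/val_inj; rewrite /= inordK.
have x3 : x (inord 3) 0 = (dsubmx (usubmx X)) 1 0.
  by rewrite !mxE; congr (x _ _); apply/val_inj; rewrite /= inordK.
rewrite x0 x1 x2 x3 -/X.
rewrite /pairing /L_gram (@quad_block T (2 + 2) (8 + 8)) -/X.
rewrite !quad_block !H_gramE !E8_gramE.
by field.
Qed.

(** The form in which the signature is used: combinations built to have no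
    positive part are shown to vanish by the sign of their norm. *)
Lemma pairing_ge0_eq0 (T : realFieldType) (x : 'cV[T]_20) :
  plus1 x = 0 -> plus2 x = 0 -> 0 <= pairing x x -> x = 0.
Proof.
move=> x1 x2; rewrite pairing_signature x1 x2 expr0n /= addr0 mul0r sub0r.
rewrite oppr_ge0 => m0.
pose X : 'cV[T]_(2 + 2 + (8 + 8)) := x.
have E1 := E8_sq_ge0 (usubmx (dsubmx X)).
have E2 := E8_sq_ge0 (dsubmx (dsubmx X)).
have S1 := sqr_ge0 (x (inord 0) 0 - x (inord 1) 0).
have S2 := sqr_ge0 (x (inord 2) 0 - x (inord 3) 0).
rewrite /minus_sq in m0; move: x1 x2; rewrite /plus1 /plus2 => x1 x2.
have /E8_sq_eq0 e1 : E8_norm (usubmx (dsubmx X)) = 0 by lra.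
have /E8_sq_eq0 e2 : E8_norm (dsubmx (dsubmx X)) = 0 by lra.
have /eqP : (x (inord 0) 0 - x (inord 1) 0) ^+ 2 = 0 by lra.
rewrite sqrf_eq0 => /eqP f1.
have /eqP : (x (inord 2) 0 - x (inord 3) 0) ^+ 2 = 0 by lra.
rewrite sqrf_eq0 => /eqP f2.
suff X0 : X = 0 by exact: X0.
rewrite -[X]vsubmxK -[dsubmx X]vsubmxK e1 e2 col_mx0.
rewrite [usubmx _](_ : _ = 0) ?col_mx0 //.
clear E1 E2 e1 e2 m0 S1 S2; apply/matrixP => -[k hk] j; rewrite ord1 !mxE.
have -> : lshift (8 + 8) (Ordinal hk) = inord k :> 'I_20.
  by apply/val_inj; rewrite /= inordK // (ltn_trans hk).
by case: k hk => [|[|[|[|//]]]] ? /=; rewrite /X; lra.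
Qed.

(* Keeps unification from computing with explicit 20 x 20 matrices. *)
Opaque pairing.

(** * Isotropic vectors and a positive definite plane *)

Section PositivePlane.
Variables (T : realFieldType) (a b : 'cV[T]_20) (p : T).
Hypotheses (p_gt0 : 0 < p) (aa : pairing a a = p) (bb : pairing b b = p)
  (ab : pairing a b = 0).
Implicit Types v w : 'cV[T]_20.

Let ba : pairing b a = 0. Proof. by rewrite pairingC. Qed.

(** The positive plane projects isomorphically on the plane of the two
    positive coordinates, so that a vector of nonnegative norm orthogonal to
    it can be corrected by an element of the plane into a vector without
    positive part, of nonnegative norm. *)
Lemma orth_plane_eq0 v :
  pairing v a = 0 -> pairing v b = 0 -> 0 <= pairing v v -> v = 0.
Proof.
move=> va vb vv.
have av : pairing a v = 0 by rewrite pairingC.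
have bv : pairing b v = 0 by rewrite pairingC.
have plus1L x y z : plus1 (x *: a + y *: b + z *: v) =
    x * plus1 a + y * plus1 b + z * plus1 v.
  by rewrite /plus1 !mxE; ring.
have plus2L x y z : plus2 (x *: a + y *: b + z *: v) =
    x * plus2 a + y * plus2 b + z * plus2 v.
  by rewrite /plus2 !mxE; ring.
have normL x y z : pairing (x *: a + y *: b + z *: v) (x *: a + y *: b + z *: v) =
    (x ^+ 2 + y ^+ 2) * p + z ^+ 2 * pairing v v.
  by rewrite !pairingE aa bb ab ba va vb av bv; ring.
have key (x y z : T) :
    x * plus1 a + y * plus1 b + z * plus1 v = 0 ->
    x * plus2 a + y * plus2 b + z * plus2 v = 0 ->
    [/\ x = 0, y = 0 & z *: v = 0].
  move=> e1 e2.
  have nn : 0 <= (x ^+ 2 + y ^+ 2) * p + z ^+ 2 * pairing v v.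
    by rewrite addr_ge0 // mulr_ge0 ?addr_ge0 ?sqr_ge0 ?(ltW p_gt0).
  have c0 : x *: a + y *: b + z *: v = 0.
    by apply: pairing_ge0_eq0; rewrite ?plus1L ?plus2L ?normL.
  have := normL x y z; rewrite c0 pairing0l => /esym/eqP.
  rewrite paddr_eq0; last first.
  - by rewrite mulr_ge0 ?sqr_ge0.
  - by rewrite mulr_ge0 ?addr_ge0 ?sqr_ge0 ?(ltW p_gt0).
  rewrite mulf_eq0 (gt_eqF p_gt0) orbF paddr_eq0 ?sqr_ge0 // !sqrf_eq0.
  move=> /andP[/andP[/eqP x0 /eqP y0] _].
  by split=> //; rewrite -c0 x0 y0 !scale0r !add0r.
pose det := plus1 a * plus2 b - plus1 b * plus2 a.
(* The coefficients are the minors of the positive coordinates of [a], [b] and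
   [v], so that the combination has no positive part. *)
have [d0|d0] := eqVneq det 0; last first.
  have [] := key (plus1 b * plus2 v - plus1 v * plus2 b)
    (plus1 v * plus2 a - plus1 a * plus2 v) det; rewrite /det; try ring.
  by move=> _ _ /eqP; rewrite scaler_eq0 (negbTE d0) => /eqP.
have [] := key (plus2 b) (- plus2 a) 0; rewrite ?mul0r ?addr0.
- by rewrite -[RHS]d0 /det; ring.
- by ring.
move=> _ /eqP; rewrite oppr_eq0 => /eqP a2 _.
have [] := key (plus1 b) (- plus1 a) 0; rewrite ?mul0r ?addr0.
- by ring.
- by transitivity (- det); [rewrite /det; ring | rewrite d0 oppr0].
move=> _ /eqP; rewrite oppr_eq0 => /eqP a1 _.
have [] := key 1 0 0; rewrite ?a1 ?a2 ?mul0r ?mulr0 ?addr0 //.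
by move/eqP; rewrite oner_eq0.
Qed.

Lemma orth_plane_le0 v :
  pairing v a = 0 -> pairing v b = 0 -> pairing v v <= 0.
Proof.
move=> va vb; rewrite leNgt; apply/negP => vv.
by move: (vv); rewrite (orth_plane_eq0 va vb (ltW vv)) pairing0l ltxx.
Qed.

(** Cauchy-Schwarz inequality on the orthogonal of the plane, where the pairing
    is negative definite. *)
Lemma orth_plane_CS v w :
  pairing v a = 0 -> pairing v b = 0 -> pairing w a = 0 -> pairing w b = 0 ->
  pairing v w ^+ 2 <= pairing v v * pairing w w.
Proof.
move=> va vb wa wb.
have [ww|ww] := leP 0 (pairing w w).
  by rewrite (orth_plane_eq0 wa wb ww) !pairing0r mulr0 expr0n.
have := @orth_plane_le0 (pairing w w *: v - pairing v w *: w).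
rewrite !pairingE va vb wa wb (pairingC w v) !mulr0 subr0 => /(_ erefl erefl).
set x := pairing v v; set y := pairing v w; set z := pairing w w in ww *.
rewrite (_ : _ + _ = z * (x * z - y ^+ 2)); last by ring.
by rewrite nmulr_rle0 // subr_ge0.
Qed.

(** [p] times the norm of the component of [v] along the plane. *)
Definition plane_sq v := pairing v a ^+ 2 + pairing v b ^+ 2.

(** The components of an isotropic vector along the plane and along its
    orthogonal have opposite norms, so by Cauchy-Schwarz both contributions to
    the pairing are bounded by the lengths along the plane; the square of their
    sum accounts for the factor 4. *)
Lemma isotropic_bound y z : pairing y y = 0 -> pairing z z = 0 ->
  (p * pairing y z) ^+ 2 <= 4 * plane_sq y * plane_sq z.
Proof.
move=> yy zz; have p0 : p != 0 by rewrite gt_eqF.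
pose orth v := p *: v - (pairing v a *: a + pairing v b *: b).
have orthP v : pairing (orth v) a = 0 /\ pairing (orth v) b = 0.
  by rewrite /orth !pairingE aa bb ab ba; split; ring.
have orthE v w : pairing (orth v) (orth w) = p * (p * pairing v w -
    (pairing v a * pairing w a + pairing v b * pairing w b)).
  by rewrite /orth !pairingE aa bb ab ba !(pairingC _ w); ring.
have [ya yb] := orthP y; have [za zb] := orthP z.
have := orth_plane_CS ya yb za zb; rewrite !orthE yy zz /plane_sq.
set m := pairing y a * _ + _; set k := p * pairing y z.
set A := pairing y a; set B := pairing y b; set A' := pairing z a.
set B' := pairing z b => le1.
have le1' : (k - m) ^+ 2 <= (A ^+ 2 + B ^+ 2) * (A' ^+ 2 + B' ^+ 2).
  have p2 : 0 < p ^+ 2 by rewrite exprn_gt0.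
  rewrite -(ler_pM2l p2) -exprMn; apply: (le_trans le1).
  by rewrite le_eqVlt; apply/orP; left; apply/eqP; ring.
have le2 : m ^+ 2 <= (A ^+ 2 + B ^+ 2) * (A' ^+ 2 + B' ^+ 2).
  rewrite -subr_ge0 (_ : _ - _ = (A * B' - B * A') ^+ 2) ?sqr_ge0 //.
  by rewrite /m -/A -/B -/A' -/B'; ring.
have := sqr_ge0 (k - m - m); rewrite -mulrA.
move: le1' le2; set S := _ * _ => le1' le2 sq.
have -> : k ^+ 2 = 2 * (k - m) ^+ 2 + 2 * m ^+ 2 - (k - m - m) ^+ 2 by ring.
move: S le1' le2 sq; clear.
move: ((k - m) ^+ 2) (m ^+ 2) ((k - m - m) ^+ 2) => ? ? ? ? ? ? ?; lra.
Qed.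

(** The lattice is discrete: the bound makes an integral pairing smaller than 1
    in absolute value. *)
Lemma small_isotropic_orth y z :
  pairing y y = 0 -> pairing z z = 0 ->
  2 * plane_sq y < p -> 2 * plane_sq z < p ->
  (exists n : int, pairing y z = n%:~R) -> pairing y z = 0.
Proof.
move=> yy zz ys zs [n yz].
have y0 : 0 <= plane_sq y by rewrite addr_ge0 ?sqr_ge0.
have z0 : 0 <= plane_sq z by rewrite addr_ge0 ?sqr_ge0.
have lt1 : (p * pairing y z) ^+ 2 < p ^+ 2.
  apply: le_lt_trans (isotropic_bound yy zz) _.
  rewrite (_ : 4 * _ * _ = (2 * plane_sq y) * (2 * plane_sq z)); last by ring.
  by rewrite expr2 ltr_pM // mulr_ge0.
move: lt1; rewrite yz exprMn -[ltRHS]mulr1 ltr_pM2l ?exprn_gt0 //.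
rewrite -rmorphXn /= -[1]/(1%:~R) ltr_int => n1.
apply/eqP; rewrite intr_eq0; apply: contraTT n1 => n0; rewrite -leNgt.
by rewrite -gtz0_ge1 exprn_even_gt0.
Qed.

(** With [z v = <v, a> + i <v, b>], this is the imaginary part of
    [z v * conj (z w)]. *)
Definition plane_det v w := pairing v b * pairing w a - pairing v a * pairing w b.

(** The bound on [plane_det] says that [y1] becomes short once its component
    along [y2] is removed; this does not change integral pairings that are
    known to vanish on [y2]. *)
Lemma reduced_planes_orth (y1 y2 z1 z2 : 'cV[T]_20) :
  (forall u v, u \in [:: y1; y2] -> v \in [:: z1; z2] ->
     exists n : int, pairing u v = n%:~R) ->
  pairing y1 y1 = 0 -> pairing y1 y2 = 0 -> pairing y2 y2 = 0 ->
  pairing z1 z1 = 0 -> pairing z1 z2 = 0 -> pairing z2 z2 = 0 ->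
  2 * plane_sq y2 < p -> 2 * plane_sq z2 < p ->
  2 * plane_det y1 y2 ^+ 2 < p * plane_sq y2 ->
  2 * plane_det z1 z2 ^+ 2 < p * plane_sq z2 ->
  [/\ pairing y1 z1 = 0, pairing y1 z2 = 0, pairing y2 z1 = 0 & pairing y2 z2 = 0].
Proof.
move=> zint y11 y12 y22 z11 z12 z22 ys zs yd zd.
have in1 (u v : 'cV[T]_20) : u \in [:: u; v] by rewrite !inE eqxx.
have in2 (u v : 'cV[T]_20) : v \in [:: u; v] by rewrite !inE eqxx orbT.
have sq0 (u v : 'cV[T]_20) : 2 * plane_det u v ^+ 2 < p * plane_sq v -> 0 < plane_sq v.
  rewrite -(pmulr_rgt0 _ p_gt0); apply: le_lt_trans.
  by rewrite mulr_ge0 ?sqr_ge0.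
have reduce (u v : 'cV[T]_20) : pairing u u = 0 -> pairing u v = 0 -> pairing v v = 0 ->
    2 * plane_det u v ^+ 2 < p * plane_sq v ->
    exists t, pairing (u - t *: v) (u - t *: v) = 0 /\ 2 * plane_sq (u - t *: v) < p.
  move=> uu uv vv /[dup] /sq0 v0 dv.
  (* The coefficient for which the components of [v] and [u - t *: v] along the
     plane are orthogonal. *)
  exists ((pairing u a * pairing v a + pairing u b * pairing v b) / plane_sq v).
  split; first by rewrite !pairingE uu (pairingC v u) uv vv; ring.
  rewrite -(ltr_pM2r v0); apply: le_lt_trans dv.
  rewrite le_eqVlt; apply/orP; left; apply/eqP.
  have : plane_sq v != 0 by rewrite gt_eqF.
  by rewrite /plane_det /plane_sq !pairingE => ?; field.
have [t [y1' y1s]] := reduce _ _ y11 y12 y22 yd.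
have [r [z1' z1s]] := reduce _ _ z11 z12 z22 zd.
have e22 : pairing y2 z2 = 0.
  by apply: (small_isotropic_orth y22 z22 ys zs); exact: zint.
have e21 : pairing y2 z1 = 0.
  have e : pairing y2 (z1 - r *: z2) = pairing y2 z1 by rewrite !pairingE e22; ring.
  by rewrite -e; apply: small_isotropic_orth => //; rewrite e; exact: zint.
have e12 : pairing y1 z2 = 0.
  have e : pairing (y1 - t *: y2) z2 = pairing y1 z2 by rewrite !pairingE e22; ring.
  by rewrite -e; apply: small_isotropic_orth => //; rewrite e; exact: zint.
split=> //; have e : pairing (y1 - t *: y2) (z1 - r *: z2) = pairing y1 z1.
  by rewrite !pairingE e22 e12 e21; ring.
by rewrite -e; apply: small_isotropic_orth => //; rewrite e; exact: zint.
Qed.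

(** A maximal isotropic subspace has dimension two: subtracting from [f] the
    combination of [y1] and [y2] with the same component along the plane leaves
    an isotropic vector of its orthogonal, that is, zero. *)
Lemma isotropic_span (y1 y2 f : 'cV[T]_20) :
  pairing y1 y1 = 0 -> pairing y1 y2 = 0 -> pairing y2 y2 = 0 ->
  pairing f f = 0 -> pairing f y1 = 0 -> pairing f y2 = 0 ->
  plane_det y1 y2 != 0 -> exists c d, f = c *: y1 + d *: y2.
Proof.
move=> y11 y12 y22 ff f1 f2 d0.
exists (plane_det f y2 / plane_det y1 y2), (plane_det y1 f / plane_det y1 y2).
set c := _ / _; set d := plane_det y1 f / _.
apply/eqP; rewrite -subr_eq0; apply/eqP; apply: orth_plane_eq0.
- by rewrite !pairingE /c /d /plane_det; move: d0; rewrite /plane_det => ?; field.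
- by rewrite !pairingE /c /d /plane_det; move: d0; rewrite /plane_det => ?; field.
rewrite !pairingE (pairingC y1 f) (pairingC y2 f) (pairingC y2 y1).
rewrite ff f1 f2 y11 y12 y22.
by rewrite le_eqVlt; apply/orP; left; apply/eqP; ring.
Qed.

End PositivePlane.

(** Independence over the integers is detected by a 2x2 minor, hence persists
    over the reals. *)
Lemma free_minor (y1 y2 : lattice) :
  (forall m n : int, m *: y1 + n *: y2 = 0 -> m = 0 /\ n = 0) ->
  exists i j, y1 i 0 * y2 j 0 - y1 j 0 * y2 i 0 != 0.
Proof.
move=> free; have [i y2i] : exists i, y2 i 0 != 0.
  apply/existsP; apply: contraT; rewrite negb_exists => /forallP z.
  suff y20 : y2 = 0.
    by have [] := free 0 1; rewrite ?y20 ?scaler0 ?scale0r ?addr0.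
  by apply/colP => i; rewrite mxE; apply/eqP; rewrite -[_ == _]negbK; exact: z.
exists i; apply/existsP; apply: contraT; rewrite negb_exists => /forallP z.
have [] := free (- y2 i 0) (y1 i 0); last first.
  by move/eqP; rewrite oppr_eq0 (negbTE y2i).
apply/colP => k; rewrite !mxE; have /eqP := negbNE (z k) => e.
by rewrite -[RHS]e; ring.
Qed.

(** Cramer's rule on a nonzero 2x2 minor turns a real linear relation between
    integral vectors into an integral one. *)
Lemma integral_relation (T : numFieldType) (y1 y2 f : lattice) (c d : T) :
  (forall m n : int, m *: y1 + n *: y2 = 0 -> m = 0 /\ n = 0) ->
  map_mx intr f = c *: map_mx intr y1 + d *: map_mx intr y2 :> 'cV[T]_20 ->
  exists k m n : int, k != 0 /\ k *: f = m *: y1 + n *: y2.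
Proof.
move=> /free_minor[i [j Dj]] ef.
have ek k : (f k 0)%:~R = c * (y1 k 0)%:~R + d * (y2 k 0)%:~R :> T.
  by move/matrixP/(_ k 0): ef; rewrite !mxE.
exists (y1 i 0 * y2 j 0 - y1 j 0 * y2 i 0),
  (f i 0 * y2 j 0 - f j 0 * y2 i 0), (y1 i 0 * f j 0 - y1 j 0 * f i 0).
split=> //; apply/colP => k; rewrite !mxE; apply/eqP; rewrite -(eqr_int T).
by rewrite !(rmorphD, rmorphN, rmorphM) /= !ek; apply/eqP; ring.
Qed.

(** * The function rho on the upper half-plane *)

Local Open Scope complex_scope.

Lemma sum2E (T : nmodType) (F : 'I_2 -> T) : \sum_i F i = F 0 + F 1.
Proof.
by rewrite !big_ord_recl big_ord0 addr0 [lift _ _](_ : _ = 1) //; apply/val_inj.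
Qed.

Lemma det_mx2 (T : comNzRingType) (m : 'M[T]_2) :
  \det m = m 0 0 * m 1 1 - m 0 1 * m 1 0.
Proof.
rewrite (expand_det_row _ 0) sum2E /cofactor !det_mx11 !mxE /=.
rewrite [lift 0 0](_ : _ = 1); last exact/val_inj.
by rewrite [lift 1 0](_ : _ = 0); [rewrite /=; ring | exact/val_inj].
Qed.

Section UpperHalfPlane.
Variable R : realType.
Implicit Types (t z : R[i]) (m : 'M[int]_2).

Lemma intrC (n : int) : n%:~R = (n%:~R : R)%:C :> R[i].
Proof. by rewrite rmorph_int. Qed.

Definition abs2 z : R := complex.Re z ^+ 2 + complex.Im z ^+ 2.

Lemma abs2_ge0 z : 0 <= abs2 z.
Proof. by rewrite addr_ge0 ?sqr_ge0. Qed.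

Lemma abs2_eq0 z : (abs2 z == 0) = (z == 0).
Proof. by case: z => a b; rewrite /abs2 eq_complex /= paddr_eq0 ?sqr_ge0 // !sqrf_eq0. Qed.

Lemma abs2_gt0 z : (0 < abs2 z) = (z != 0).
Proof. by rewrite lt_def abs2_ge0 andbT abs2_eq0. Qed.

Lemma abs2M z1 z2 : abs2 (z1 * z2) = abs2 z1 * abs2 z2.
Proof. by case: z1 z2 => a b [c d]; rewrite /abs2 /=; ring. Qed.

Definition mob_den m t : R[i] := (m 1 0)%:~R * t + (m 1 1)%:~R.

Lemma Im_mobius m t : complex.Im (mobius m t) =
  (\det m)%:~R * complex.Im t / abs2 (mob_den m t).
Proof.
rewrite det_mx2 /mobius /mob_den !intrC.
rewrite !(rmorphD, rmorphN, rmorphM) /=.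
move: (m 0 0)%:~R (m 0 1)%:~R (m 1 0)%:~R (m 1 1)%:~R => a b c d.
by case: t => x y; rewrite /abs2 /=; ring.
Qed.

Lemma mob_den_neq0 m t : \det m = 1 -> 0 < complex.Im t -> mob_den m t != 0.
Proof.
rewrite /mob_den => dm t0; apply/eqP => d0.
have c0 : m 1 0 = 0.
  move: d0; rewrite !intrC; case: t t0 => x y /= y0 [_] /eqP.
  by rewrite !mul0r !addr0 mulf_eq0 (gt_eqF y0) orbF intr_eq0 => /eqP.
move: d0; rewrite c0 mul0r add0r => /eqP; rewrite intr_eq0 => /eqP d0.
by move: dm; rewrite det_mx2 c0 d0 !mulr0 subr0.
Qed.

Lemma mobius_Im_gt0 m t : \det m = 1 -> 0 < complex.Im t ->
  0 < complex.Im (mobius m t).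
Proof.
move=> dm t0; rewrite Im_mobius dm mul1r divr_gt0 //.
by rewrite abs2_gt0 mob_den_neq0.
Qed.

Lemma mobiusM m1 m2 t : \det m2 = 1 -> 0 < complex.Im t ->
  mobius (m1 *m m2) t = mobius m1 (mobius m2 t).
Proof.
move=> dm t0; have := mob_den_neq0 dm t0; rewrite /mobius /mob_den.
have E (i j : 'I_2) : (m1 *m m2) i j = m1 i 0 * m2 0 j + m1 i 1 * m2 1 j.
  by rewrite mxE sum2E.
rewrite !E !(rmorphD, rmorphM) /=.
move: (m1 0 0)%:~R (m1 0 1)%:~R (m1 1 0)%:~R (m1 1 1)%:~R => a b c d.
set N := (m2 0 0)%:~R * t + _; set D := (m2 1 0)%:~R * t + _ => D0.
rewrite (_ : a * (N / D) + b = (a * N + b * D) / D); last by field.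
rewrite (_ : c * (N / D) + d = (c * N + d * D) / D); last by field.
by rewrite invf_div mulrA divfK //; congr (_ / _); rewrite /N /D; ring.
Qed.

Lemma int_sqr_ge1 (n : int) : n != 0 -> 1 <= (n%:~R : R) ^+ 2.
Proof.
move=> n0; rewrite -rmorphXn /= -[1]/(1%:~R) ler_int.
by rewrite -gtz0_ge1 exprn_even_gt0.
Qed.

Lemma abs2_mob_den m t : abs2 (mob_den m t) =
  ((m 1 0)%:~R * complex.Re t + (m 1 1)%:~R) ^+ 2 +
  (m 1 0)%:~R ^+ 2 * complex.Im t ^+ 2.
Proof. by rewrite /mob_den !intrC; case: t => x y; rewrite /abs2 /=; ring. Qed.

Let orbit t := [set complex.Im (mobius m t) | m in SL2Z].

(** Denominators [c t + d] with [c <> 0] have modulus at least [Im t], and those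
    with [c = 0] have modulus at least 1. *)
Lemma mob_has_sup t : 0 < complex.Im t -> has_sup (orbit t).
Proof.
move=> t0; split; first by exists (complex.Im (mobius 1%:M t)), 1%:M; rewrite // /SL2Z /= det1.
exists (complex.Im t + (complex.Im t)^-1) => _ [m dm <-].
rewrite /SL2Z /= in dm; rewrite Im_mobius dm mul1r; have := mob_den_neq0 dm t0; rewrite -abs2_gt0 => d0.
rewrite ler_pdivrMr // abs2_mob_den.
have [c0|c0] := eqVneq (m 1 0) 0.
  have d1 : m 1 1 != 0.
    by apply/eqP => d1; move: dm; rewrite det_mx2 c0 d1 !mulr0 subr0.
  rewrite c0 mulr0z mul0r add0r expr0n /= mul0r addr0.
  have := int_sqr_ge1 d1; have : 0 < (complex.Im t)^-1 by rewrite invr_gt0.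
  by move: (complex.Im t) t0 => y; nra.
have := int_sqr_ge1 c0; set u := _ ^+ 2 => u1.
have := sqr_ge0 ((m 1 0)%:~R * complex.Re t + (m 1 1)%:~R : R).
set v := _ ^+ 2 => v0.
have yV : complex.Im t * (complex.Im t)^-1 = 1 by rewrite divff ?gt_eqF.
have : 0 < (complex.Im t)^-1 by rewrite invr_gt0.
move: (complex.Im t) (complex.Im t)^-1 t0 yV => y z y0 yz z0.
have -> : (y + z) * (v + u * y ^+ 2) = y * (v + u * y ^+ 2) + z * v + u * y * (y * z).
  by ring.
have h1 : 0 <= y * (v + u * y ^+ 2).
  by rewrite mulr_ge0 ?(ltW y0) // addr_ge0 // mulr_ge0 ?sqr_ge0 // (le_trans ler01).
have h2 : 0 <= z * v by rewrite mulr_ge0 // ltW.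
have h3 : y <= u * y by rewrite ler_peMl // ltW.
rewrite yz; lra.
Qed.

Lemma Im_mobius_le_rho m t : \det m = 1 -> 0 < complex.Im t ->
  complex.Im (mobius m t) <= rho t.
Proof.
by move=> dm t0; apply: ub_le_sup; [exact: (mob_has_sup t0).2 | exists m].
Qed.

Lemma mobius1 t : mobius 1%:M t = t.
Proof. by rewrite /mobius !mxE /= !mulr1z !mulr0z mul1r mul0r add0r addr0 divr1. Qed.

Lemma Im_le_rho t : 0 < complex.Im t -> complex.Im t <= rho t.
Proof. by move=> t0; rewrite -{1}[t]mobius1; apply: Im_mobius_le_rho; rewrite ?det1. Qed.

Lemma rho_mobius m t : \det m = 1 -> 0 < complex.Im t -> rho (mobius m t) = rho t.
Proof.
move=> dm t0; congr sup; apply/seteqP; split=> _ [m' dm' <-].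
  exists (m' *m m); rewrite ?mobiusM // /SL2Z /=.
  by rewrite det_mulmx dm dm' mulr1.
have mU : m \in unitmx by rewrite unitmxE dm unitr1.
have dV : \det (invmx m) = 1 by rewrite det_inv dm invr1.
exists (m' *m invmx m); first by rewrite /SL2Z /= det_mulmx dm' dV mulr1.
by rewrite -mobiusM // mulmxKV.
Qed.

(** Translating by an integer and inverting multiplies a small imaginary part
    by a definite factor, so the supremum of the orbit is at least that of the
    corners of the fundamental domain. *)
Lemma rho_sqr_ge t : 0 < complex.Im t -> 3 / 4 <= rho t ^+ 2.
Proof.
move=> t0; have r0 : 0 < rho t by rewrite (lt_le_trans t0) ?Im_le_rho.
rewrite leNgt; apply/negP => r34.
have := sup_gt (mob_has_sup t0).1; rewrite -/(rho t).
move=> /(_ (rho t * (1 / 4 + rho t ^+ 2))) [|_ [m dm <-] mgt].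
  by rewrite -[ltRHS]mulr1 ltr_pM2l //; lra.
set t' := mobius m t in mgt.
have t'0 : 0 < complex.Im t' by exact: mobius_Im_gt0.
pose n := Num.floor (complex.Re t' + 1 / 2).
(* [s] maps [t'] to [-1 / (t' - n)], where [t' - n] has real part at most 1/2 in
   absolute value. *)
pose s : 'M[int]_2 := \matrix_(i, j) (if i == 0 then (j == 1)%:R *- 1 else if j == 0 then 1 else - n).
have ds : \det s = 1 by rewrite det_mx2 !mxE /=; lia.
have := Im_mobius_le_rho (m := s *m m) (t := t).
rewrite det_mulmx ds dm mulr1 => /(_ erefl t0).
rewrite mobiusM // -/t' Im_mobius ds mul1r leNgt => /negP; apply.
rewrite abs2_mob_den !mxE /=.
have /andP[] := floor_itv (complex.Re t' + 1 / 2); rewrite -/n rmorphD rmorphN /=.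
have y_le : complex.Im t' <= rho t by exact: Im_mobius_le_rho.
have d0 : 0 < (1 * complex.Re t' - n%:~R) ^+ 2 + 1 ^+ 2 * complex.Im t' ^+ 2.
  by rewrite ltr_wpDl ?sqr_ge0 // mulr_gt0 ?exprn_gt0.
move=> n1 n2; rewrite ltr_pdivlMr //; apply: le_lt_trans mgt.
rewrite ler_pM2l //.
have : (complex.Re t' - n%:~R) ^+ 2 <= 1 / 4.
  by move: (complex.Re t') (n%:~R) n1 n2 => x k; rewrite mulr1z => ? ?; nra.
have : complex.Im t' ^+ 2 <= rho t ^+ 2.
  by rewrite ler_sqr ?nnegrE ?(ltW t'0) ?(ltW r0).
rewrite !mul1r expr1n mul1r => ? ?; lra.
Qed.

(** The supremum is only approximated, which is enough because the threshold is
    strict. *)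
Lemma mobius_Im_gt t c : 0 < complex.Im t -> 0 < c -> c ^+ 2 < 3 / 4 ->
  exists2 m, \det m = 1 & c < complex.Im (mobius m t).
Proof.
move=> t0 c0 c34; have [_ [m dm <-] mc] : exists2 y, orbit t y & c < y.
  apply: sup_gt; first exact: (mob_has_sup t0).1.
  rewrite -/(rho t); have r0 : 0 < rho t by rewrite (lt_le_trans t0) ?Im_le_rho.
  by rewrite -ltr_sqr ?nnegrE ?(ltW c0) ?(ltW r0) // (lt_le_trans c34) ?rho_sqr_ge.
by exists m.
Qed.

(** Upper semicontinuity: all denominators [c t + d] of the orbit vary by the
    same factor when [t] moves by a small proportion of its imaginary part. *)
Lemma rho_usc t r : 0 < complex.Im t -> rho t < r ->
  exists2 e, 0 < e & forall z, 0 < complex.Im z -> abs2 (z - t) < e ^+ 2 -> rho z <= r.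
Proof.
move=> t0 rt; have r0 : 0 < rho t by rewrite (lt_le_trans t0) ?Im_le_rho.
(* [k] solves [(1 + k) * rho t = r * (1 - 2 * k)]: moving [t] by [k * Im t]
   changes imaginary parts by a factor at most [1 + k] and squared denominators
   by a factor at least [1 - 2 * k]. *)
pose k := (r - rho t) / (rho t + 2 * r).
have k0 : 0 < k by rewrite divr_gt0; lra.
have kr : (1 + k) * rho t <= r * (1 - 2 * k).
  have : k * (rho t + 2 * r) = r - rho t by rewrite divfK //; lra.
  lra.
have k1 : 2 * k < 1 by rewrite /k mulrA ltr_pdivrMr; lra.
clearbody k; exists (k * complex.Im t); first by rewrite mulr_gt0.
move=> z z0 zt; apply: sup_le_ub; first exact: (mob_has_sup z0).1.
move=> _ [m dm <-]; rewrite /SL2Z /= in dm.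
have := Im_mobius_le_rho dm t0; rewrite !Im_mobius dm !mul1r.
have := mob_den_neq0 dm t0; rewrite -abs2_gt0 => dt.
have := mob_den_neq0 dm z0; rewrite -abs2_gt0 => dz.
rewrite !ler_pdivrMr // => Imt.
have Imz : complex.Im z <= (1 + k) * complex.Im t.
  have : (complex.Im z - complex.Im t) ^+ 2 <= (k * complex.Im t) ^+ 2.
    apply: le_trans (ltW zt); rewrite /abs2.
    by case: (z) (t) => a b [c d] /=; rewrite lerDr sqr_ge0.
  have k2 : 0 < k * complex.Im t by rewrite mulr_gt0.
  rewrite leNgt => /negP sq; rewrite leNgt; apply/negP => lt; apply: sq.
  by rewrite ltr_sqr ?nnegrE; lra.
have den : (1 - 2 * k) * abs2 (mob_den m t) <= abs2 (mob_den m z).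
  rewrite !abs2_mob_den; move: zt; rewrite /abs2 {Imz Imt dz dt z0 t0 kr}.
  case: z t {rt r0} => a b [a' b'] /=; move: (m 1 0)%:~R (m 1 1)%:~R => c d zt.
  set A1 := c * a' + d; set A2 := c * b'.
  have -> : c * a + d = A1 + c * (a - a') by rewrite /A1; ring.
  have -> : c ^+ 2 * b' ^+ 2 = A2 ^+ 2 by rewrite /A2; ring.
  have -> : c ^+ 2 * b ^+ 2 = (A2 + c * (b - b')) ^+ 2 by rewrite /A2; ring.
  set B1 := c * (a - a'); set B2 := c * (b - b').
  have le1 : B1 ^+ 2 + B2 ^+ 2 <= k ^+ 2 * (A1 ^+ 2 + A2 ^+ 2).
    have -> : B1 ^+ 2 + B2 ^+ 2 = c ^+ 2 * ((a - a') ^+ 2 + (b - b') ^+ 2).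
      by rewrite /B1 /B2; ring.
    apply: le_trans (ler_wpM2l (sqr_ge0 c) (ltW zt)) _.
    have -> : c ^+ 2 * (k * b') ^+ 2 = k ^+ 2 * A2 ^+ 2 by rewrite /A2; ring.
    by rewrite ler_wpM2l ?sqr_ge0 // lerDr sqr_ge0.
  have := sqr_ge0 (k * A1 + B1); have := sqr_ge0 (k * A2 + B2) => s2 s1.
  have le2 : - (2 * k ^+ 2 * (A1 ^+ 2 + A2 ^+ 2)) <= 2 * k * (A1 * B1 + A2 * B2).
    have e1 : (k * A1 + B1) ^+ 2 = k ^+ 2 * A1 ^+ 2 + 2 * k * (A1 * B1) + B1 ^+ 2 by ring.
    have e2 : (k * A2 + B2) ^+ 2 = k ^+ 2 * A2 ^+ 2 + 2 * k * (A2 * B2) + B2 ^+ 2 by ring.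
    move: le1 s1 s2; rewrite e1 e2; lra.
  have le3 : - (2 * k * (A1 ^+ 2 + A2 ^+ 2)) <= 2 * (A1 * B1 + A2 * B2).
    rewrite -(ler_pM2l k0); apply: le_trans (le_trans _ le2) _; lra.
  have := sqr_ge0 B1; have := sqr_ge0 B2.
  have -> : (A1 + B1) ^+ 2 + (A2 + B2) ^+ 2 = A1 ^+ 2 + A2 ^+ 2 +
      2 * (A1 * B1 + A2 * B2) + (B1 ^+ 2 + B2 ^+ 2) by ring.
  by move: (B1 ^+ 2) (B2 ^+ 2) => ? ?; lra.
apply: (le_trans Imz); apply: (@le_trans _ _ ((1 + k) * rho t * abs2 (mob_den m t))).
  by rewrite -mulrA ler_pM2l //; lra.
apply: le_trans (_ : r * (1 - 2 * k) * abs2 (mob_den m t) <= _).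
  by rewrite ler_pM2r.
by rewrite -mulrA ler_pM2l // (lt_trans r0).
Qed.

End UpperHalfPlane.

(** * Period vectors *)

Opaque C_form rho.

Section Vectors.
Variable R : realType.
Implicit Types (u v w : 'cV[R[i]]_20) (y f : lattice).

Definition vre w : 'cV[R]_20 := map_mx (@complex.Re R) w.
Definition vim w : 'cV[R]_20 := map_mx (@complex.Im R) w.
Definition real_vec y : 'cV[R]_20 := map_mx intr y.

Lemma vec_split w : w = map_mx (real_complex R) (vre w) + 'i *: map_mx (real_complex R) (vim w).
Proof. by apply/colP => k; rewrite !mxE -complexE. Qed.

Lemma pairing_reim u v : pairing u v =
  (pairing (vre u) (vre v) - pairing (vim u) (vim v)) +i*
  (pairing (vre u) (vim v) + pairing (vim u) (vre v)).
Proof.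
rewrite {1}(vec_split u) {1}(vec_split v) !pairingE -!map_pairing.
by apply/eqP; rewrite eq_complex /=; apply/andP; split; apply/eqP; ring.
Qed.

Lemma vre_conj w : vre (conj_vec w) = vre w.
Proof. by apply/colP => k; rewrite !mxE; case: (w k 0). Qed.

Lemma vim_conj w : vim (conj_vec w) = - vim w.
Proof. by apply/colP => k; rewrite !mxE; case: (w k 0). Qed.

Definition herm w : R := pairing (vre w) (vre w) + pairing (vim w) (vim w).

Lemma pairing_conj w : pairing w (conj_vec w) = (herm w)%:C.
Proof.
rewrite pairing_reim vre_conj vim_conj !pairingE opprK (pairingC (vim w) (vre w)).
by rewrite addNr.
Qed.

(** The Riemann relations on real and imaginary parts: they span a positive
    definite plane, of which they are an orthogonal basis of equal norms. *)
Definition period_vector w :=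
  [/\ pairing (vre w) (vre w) = pairing (vim w) (vim w),
      pairing (vre w) (vim w) = 0 & 0 < pairing (vre w) (vre w)].

Lemma pairing_eq0P w : pairing w w = 0 <->
  pairing (vre w) (vre w) = pairing (vim w) (vim w) /\ pairing (vre w) (vim w) = 0.
Proof.
rewrite pairing_reim (pairingC (vim w) (vre w)); split=> [[e1 e2]|[-> ->]].
  by split; lra.
by rewrite subrr addr0.
Qed.

Lemma period_vectorP w :
  period_vector w <-> pairing w w = 0 /\ 0 < herm w.
Proof.
rewrite pairing_eq0P /herm; split=> [[e1 e2 e3]|[[e1 e2] e3]]; split=> //.
  by rewrite -e1; lra.
by move: e3; rewrite -e1; lra.
Qed.

Lemma OmegaP (x : proj_space R) : Omega x <-> period_vector (spanning x).
Proof.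
by rewrite period_vectorP /Omega /= !C_formE pairing_conj ltcR.
Qed.

Lemma C_form_lat w y :
  C_form w (to_C R y) = pairing (real_vec y) (vre w) +i* pairing (real_vec y) (vim w).
Proof.
have re : vre (to_C R y) = real_vec y.
  by apply/colP => k; rewrite !mxE intrC.
have im : vim (to_C R y) = 0 by apply/colP => k; rewrite !mxE intrC.
rewrite C_formE pairing_reim re im !pairing0r subr0 add0r.
by rewrite !(pairingC (real_vec y)).
Qed.

(** The covolume [Im (z1 * conj z2)] of the lattice of periods [z1], [z2] of a
    basis of V; [u2] is [herm / (4 * area)]. *)
Definition area w (y : lattice * lattice) : R :=
  plane_det (vre w) (vim w) (real_vec y.1) (real_vec y.2).

Definition vratio w (y : lattice * lattice) : R[i] :=
  C_form w (to_C R y.1) / C_form w (to_C R y.2).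

Lemma abs2_C_form w y :
  abs2 (C_form w (to_C R y)) = plane_sq (vre w) (vim w) (real_vec y).
Proof. by rewrite C_form_lat. Qed.

Lemma Im_vratio w (y : lattice * lattice) :
  complex.Im (vratio w y) = area w y / abs2 (C_form w (to_C R y.2)).
Proof. by rewrite /vratio !C_form_lat /area /plane_det /abs2 /=; ring. Qed.

Lemma ReZ (c z : R[i]) : complex.Re (c * z) =
  complex.Re c * complex.Re z - complex.Im c * complex.Im z.
Proof. by case: c z => ? ? []. Qed.

Lemma ImZ (c z : R[i]) : complex.Im (c * z) =
  complex.Re c * complex.Im z + complex.Im c * complex.Re z.
Proof. by case: c z => ? ? []. Qed.

Lemma vreZ c w : vre (c *: w) = complex.Re c *: vre w - complex.Im c *: vim w.
Proof. by apply/colP => k; rewrite !mxE ReZ. Qed.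

Lemma vimZ c w : vim (c *: w) = complex.Re c *: vim w + complex.Im c *: vre w.
Proof. by apply/colP => k; rewrite !mxE ImZ. Qed.

Lemma hermZ c w : herm (c *: w) = abs2 c * herm w.
Proof.
rewrite /herm vreZ vimZ !pairingE (pairingC (vim w) (vre w)) /abs2; ring.
Qed.

Lemma areaZ c w (y : lattice * lattice) : area (c *: w) y = abs2 c * area w y.
Proof. by rewrite /area /plane_det vreZ vimZ !pairingE /abs2; ring. Qed.

Lemma vratioZ c w (y : lattice * lattice) : c != 0 -> vratio (c *: w) y = vratio w y.
Proof. by move=> c0; rewrite /vratio !C_formE !pairingE -mulf_div divff ?mul1r. Qed.

Lemma period_vectorZ c w : c != 0 -> period_vector (c *: w) <-> period_vector w.
Proof.
move=> c0; rewrite !period_vectorP hermZ !pairingE.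
rewrite pmulr_rgt0 ?abs2_gt0 //; split=> -[e1 ->]; split=> //.
  by apply/eqP; move/eqP: e1; rewrite !mulf_eq0 (negbTE c0).
by rewrite e1 !mulr0.
Qed.

(** A lattice vector with zero period is orthogonal to the positive plane, and
    there are no nonzero isotropic vectors in its orthogonal. *)
Lemma abs2_C_form_gt0 w y : period_vector w -> lat_form y y = 0 -> y != 0 ->
  0 < abs2 (C_form w (to_C R y)).
Proof.
move=> [ab aob a0] yy; rewrite abs2_gt0; apply: contra => /eqP.
rewrite C_form_lat => -[e1 e2].
have yr : real_vec y = 0.
  apply: (orth_plane_eq0 a0 erefl (esym ab) aob e1 e2).
  by rewrite -lat_formE yy.
apply/eqP/colP => k; move/colP/(_ k): yr; rewrite !mxE => /eqP.
by rewrite intr_eq0 => /eqP.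
Qed.

End Vectors.

(** * Points of projective space and bases of V *)

Local Open Scope quotient_scope.

Section Points.
Variable R : realType.
Implicit Types (u v w : 'cV[R[i]]_20) (x : proj_space R) (g : 'M[R[i]]_20).

(** Points are handled through arbitrary spanning vectors; the chosen one only
    appears through its proportionality to the others. *)
Definition spans w x := exists2 c : R[i], c != 0 & w = c *: spanning x.

Lemma spanning_neq0 x : spanning x != 0.
Proof. by have := valP (repr (x : {eq_quot (@collinear R)})); rewrite inE. Qed.

Lemma spans_self x : spans (spanning x) x.
Proof. by exists 1; rewrite ?oner_neq0 ?scale1r. Qed.

Lemma spansZ c w x : c != 0 -> spans w x -> spans (c *: w) x.
Proof. by move=> c0 [d d0 ->]; exists (c * d); rewrite ?mulf_neq0 ?scalerA. Qed.

Lemma spans_neq0 w x : spans w x -> w != 0.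
Proof. by move=> [c c0 ->]; rewrite scaler_eq0 negb_or c0 spanning_neq0. Qed.

Lemma spans_inj w x x' : spans w x -> spans w x' -> x = x'.
Proof.
move=> [c c0 ->] [d d0 e].
rewrite -[x]reprK -[x']reprK; apply/eqmodP/asboolP.
exists (c^-1 * d); first by rewrite mulf_neq0 ?invr_eq0.
by rewrite -[RHS]scalerA -[X in _ = _ *: X]e scalerA mulVf // scale1r.
Qed.

Lemma spans_pi (v : @nonzero_vectors R) :
  spans (\val v) (\pi_{eq_quot (@collinear R)} v : proj_space R).
Proof.
have /eqmodP/asboolP[c c0 e] : v = repr (\pi_{eq_quot (@collinear R)} v) %[mod {eq_quot (@collinear R)}].
  by rewrite reprK.
by exists c.
Qed.

Definition proj_pt w (w0 : w != 0) : proj_space R :=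
  \pi_{eq_quot (@collinear R)} (SigSub (mem_set w0 : w \in @nonzero_vectors R)).

Lemma spans_pt w (w0 : w != 0) : spans w (proj_pt w0).
Proof. exact: (spans_pi (SigSub (mem_set w0 : w \in @nonzero_vectors R))). Qed.

Lemma spans_act g x w : spans w x -> g *m w != 0 -> spans (g *m w) (proj_act g x).
Proof.
move=> [c c0 e] gw0; rewrite e -scalemxAr; apply: spansZ => //.
have gx0 : g *m spanning x != 0.
  by apply: contra gw0 => /eqP gx0; rewrite e -scalemxAr gx0 scaler0.
have := spans_pi (insubd (repr (x : {eq_quot (@collinear R)})) (g *m spanning x)).
by rewrite val_insubd (mem_set (gx0 : nonzero_vectors _)).
Qed.

Lemma period_vector_spans w x : spans w x -> Omega x <-> period_vector w.
Proof. by move=> [c c0 ->]; rewrite OmegaP period_vectorZ. Qed.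

End Points.

Section Bases.
Variable R : realType.
Implicit Types (w : 'cV[R[i]]_20) (x : proj_space R) (V : set lattice)
  (y z : lattice * lattice).

Lemma real_vecD (a b : lattice) : real_vec R (a + b) = real_vec R a + real_vec R b.
Proof. by apply/colP => k; rewrite !mxE rmorphD. Qed.

Lemma real_vecZ (n : int) (a : lattice) : real_vec R (n *: a) = n%:~R *: real_vec R a.
Proof. by apply/colP => k; rewrite !mxE rmorphM. Qed.

Lemma unit_int_or (a b : int) : a * b = 1 -> b = 1 \/ b = -1.
Proof.
move=> ab; have : b \is a GRing.unit by apply/unitrPr; exists a; rewrite mulrC.
by rewrite unfold_in => /orP[] /eqP; [left|right].
Qed.

Lemma Zbasis_mem V y : Zbasis V y -> V y.1 /\ V y.2.
Proof.
move=> [-> _]; split; first by exists 1 => //; exists 0; rewrite // scale1r scale0r addr0.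
by exists 0 => //; exists 1; rewrite // scale1r scale0r add0r.
Qed.

(** The change of basis matrix and its inverse are both integral, so the
    determinant is a unit. *)
Lemma Zbasis_change V y z : Zbasis V y -> Zbasis V z ->
  exists2 m : 'M[int]_2, \det m = 1 \/ \det m = -1 &
    z.1 = m 0 0 *: y.1 + m 0 1 *: y.2 /\ z.2 = m 1 0 *: y.1 + m 1 1 *: y.2.
Proof.
move=> /[dup] yb [Vy fy] /[dup] zb [Vz _].
have [y1 y2] := Zbasis_mem yb; have [z1 z2] := Zbasis_mem zb.
move: z1 z2 y1 y2; rewrite {1 2}Vy Vz.
move=> [a _ [b _ ez1]] [c _ [d _ ez2]] [a' _ [b' _ ey1]] [c' _ [d' _ ey2]].
have eq1 : (a' * a + b' * c - 1) *: y.1 + (a' * b + b' * d) *: y.2 = 0.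
  rewrite -[RHS](subrr y.1) -{2}ey1 -ez1 -ez2.
  by apply/colP => k; rewrite !mxE; ring.
have eq2 : (c' * a + d' * c) *: y.1 + (c' * b + d' * d - 1) *: y.2 = 0.
  rewrite -[RHS](subrr y.2) -{2}ey2 -ez1 -ez2.
  by apply/colP => k; rewrite !mxE; ring.
have [e1 e2] := fy _ _ eq1; have [e3 e4] := fy _ _ eq2.
pose m : 'M[int]_2 := \matrix_(i, j)
  if i == 0 then (if j == 0 then a else b) else (if j == 0 then c else d).
exists m; last by rewrite !mxE /= ez1 ez2.
rewrite det_mx2 !mxE /=; apply: (@unit_int_or (a' * d' - b' * c')).
rewrite (_ : _ * _ = (a' * a + b' * c) * (c' * b + d' * d) -
  (a' * b + b' * d) * (c' * a + d' * c)); last by ring.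
by rewrite e2 e3 mul0r subr0; move/eqP: e1; rewrite subr_eq0 => /eqP ->;
   move/eqP: e4; rewrite subr_eq0 => /eqP ->.
Qed.

Lemma area_change w y z (m : 'M[int]_2) :
  z.1 = m 0 0 *: y.1 + m 0 1 *: y.2 -> z.2 = m 1 0 *: y.1 + m 1 1 *: y.2 ->
  area w z = (\det m)%:~R * area w y.
Proof.
rewrite /area /plane_det det_mx2 => -> ->.
rewrite !real_vecD !real_vecZ !pairingE !(rmorphD, rmorphN, rmorphM) /=; ring.
Qed.

Lemma area_neq0 w y : area w y != 0 -> C_form w (to_C R y.2) != 0.
Proof.
apply: contra; rewrite C_form_lat /area /plane_det => /eqP[-> ->].
by rewrite !mulr0 subrr.
Qed.

Lemma vratio_change w y z (m : 'M[int]_2) :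
  z.1 = m 0 0 *: y.1 + m 0 1 *: y.2 -> z.2 = m 1 0 *: y.1 + m 1 1 *: y.2 ->
  C_form w (to_C R y.2) != 0 -> vratio w z = mobius m (vratio w y).
Proof.
rewrite /vratio /mobius => -> -> /negP/negP.
have E (a b : int) (u v : lattice) : C_form w (to_C R (a *: u + b *: v)) =
    a%:~R * C_form w (to_C R u) + b%:~R * C_form w (to_C R v).
  rewrite !C_formE -!pairingZr -pairingDr; congr pairing.
  by apply/colP => k; rewrite !mxE rmorphD !rmorphM.
rewrite !E; set Z1 := C_form w (to_C R y.1); set Z2 := C_form w (to_C R y.2) => Z0.
move: (m 0 0)%:~R (m 0 1)%:~R (m 1 0)%:~R (m 1 1)%:~R => a b c d.
rewrite (_ : a * (Z1 / Z2) + b = (a * Z1 + b * Z2) / Z2); last by field.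
rewrite (_ : c * (Z1 / Z2) + d = (c * Z1 + d * Z2) / Z2); last by field.
by rewrite invf_div mulrA divfK.
Qed.

Lemma Im_vratio_gt0 w y : 0 < area w y -> 0 < complex.Im (vratio w y).
Proof.
by move=> a0; rewrite Im_vratio divr_gt0 // abs2_gt0 area_neq0 // gt_eqF.
Qed.

Lemma area_gt0 w y : 0 < complex.Im (vratio w y) -> 0 < area w y.
Proof.
rewrite Im_vratio; have [->|/negbTE Z0] := eqVneq (C_form w (to_C R y.2)) 0.
  by rewrite /abs2 /= expr0n /= addr0 invr0 mulr0 ltxx.
by rewrite pmulr_lgt0 // invr_gt0 abs2_gt0 Z0.
Qed.

(** Positivity of both areas selects determinant 1, and [rho] is invariant
    under SL(2, Z). *)
Lemma pos_basis_change w V y z : Zbasis V y -> Zbasis V z ->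
  0 < area w y -> 0 < area w z ->
  area w z = area w y /\ rho (vratio w z) = rho (vratio w y).
Proof.
move=> yb zb y0 z0; have [m dm [ez1 ez2]] := Zbasis_change yb zb.
have := area_change w ez1 ez2; case: dm => dm; rewrite dm; last first.
  by move=> e; move: z0; rewrite e mulN1r oppr_gt0 ltNge ltW.
rewrite mulr1z mul1r => ->; split; first exact: erefl.
rewrite (vratio_change ez1 ez2); last by rewrite area_neq0 // gt_eqF.
by apply: rho_mobius; [exact: dm | exact: Im_vratio_gt0].
Qed.

Lemma period_basisP V x y : Zbasis V y -> 0 < area (spanning x) y ->
  Zbasis V (period_basis V x) /\ 0 < area (spanning x) (period_basis V x).
Proof.
move=> yb y0; rewrite /period_basis; case: xgetP => [z -> [zb z0]|/(_ y)].
  by split=> //; apply: area_gt0.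
by case; split=> //; apply: Im_vratio_gt0.
Qed.

(** Rescaling a spanning vector multiplies [herm] and [area] by the same factor,
    and positively oriented bases differ by SL(2, Z). *)
Lemma invariantsE V x w y : spans w x -> Zbasis V y -> 0 < area w y ->
  u2 V x = herm w / (4 * area w y) /\ rho (tau V x) = rho (vratio w y).
Proof.
move=> [c c0 ->] yb; have c1 : 0 < abs2 c by rewrite abs2_gt0.
rewrite areaZ hermZ (vratioZ _ _ c0) (pmulr_rgt0 _ c1) => y0.
have [zb z0] := period_basisP yb y0; have [ea er] := pos_basis_change yb zb y0 z0.
rewrite -er -ea; split; last exact: erefl.
rewrite /u2 /tau -/(vratio (spanning x) _) /period C_formE pairing_conj.
rewrite Im_vratio -add_Re2_Im2 -/(abs2 _); set z := period_basis V x.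
have Z0 : abs2 (C_form (spanning x) (to_C R z.2)) != 0.
  apply: lt0r_neq0; rewrite abs2_gt0; apply: area_neq0.
  exact: lt0r_neq0 z0.
have ReE (a b : R) : complex.Re (a%:C / b%:C) = a / b.
  by rewrite -fmorphV -rmorphM.
rewrite -[4](rmorph_nat (real_complex R)) -!rmorphM ReE.
have : abs2 c != 0 by rewrite gt_eqF.
have : area (spanning x) z != 0 by exact: lt0r_neq0 z0.
move: (abs2 _) (abs2 _) (area _ _) (herm _) Z0 => A B d h A0 d0 B0.
by field; rewrite A0 d0 B0.
Qed.

End Bases.

(** * Invariance under isometries and separation of cusps *)

Section Isotropic.
Variable R : realType.
Implicit Types (w : 'cV[R[i]]_20) (x : proj_space R) (V : set lattice)
  (y z : lattice * lattice).

Lemma real_lat_form (a b : lattice) :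
  pairing (real_vec R a) (real_vec R b) = (lat_form a b)%:~R.
Proof. by rewrite lat_formE. Qed.

(** Zero area would make the two periods proportional over the reals; the
    corresponding real combination of the basis is isotropic with zero period,
    so it vanishes, against independence. *)
Lemma area_period_neq0 V w y : (forall a b, V a -> V b -> lat_form a b = 0) ->
  Zbasis V y -> period_vector w -> area w y != 0.
Proof.
move=> Viso yb pw; have [y1 y2] := Zbasis_mem yb; have [_ free] := yb.
have y20 : y.2 != 0.
  by apply/eqP => y20; have [] := free 0 1; rewrite ?y20 ?scaler0 ?scale0r ?addr0.
have := abs2_C_form_gt0 pw (Viso _ _ y2 y2) y20; rewrite abs2_C_form.
set a := vre w; set b := vim w; set s := plane_sq a b _ => s0.
apply/eqP => area0; have [ab aob a0] := pw.
pose Y1 := real_vec R y.1; pose Y2 := real_vec R y.2.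
pose t := (pairing Y1 a * pairing Y2 a + pairing Y1 b * pairing Y2 b) / s.
have ts : t * s = pairing Y1 a * pairing Y2 a + pairing Y1 b * pairing Y2 b.
  by rewrite /t divfK ?gt_eqF.
have Y12 : Y1 - t *: Y2 = 0.
  have area0' : pairing Y1 b * pairing Y2 a = pairing Y1 a * pairing Y2 b.
    by apply/eqP; rewrite -subr_eq0; apply/eqP; exact: area0.
  have sE : s = pairing Y2 a ^+ 2 + pairing Y2 b ^+ 2 by [].
  apply: (orth_plane_eq0 a0 erefl (esym ab) aob).
  - apply: (mulIf (lt0r_neq0 s0)); rewrite mul0r !pairingE.
    rewrite (_ : _ * s = pairing Y1 a * s - (t * s) * pairing Y2 a); last by ring.
    rewrite ts sE.
    rewrite (_ : _ - _ = (pairing Y1 a * pairing Y2 b - pairing Y1 b * pairing Y2 a) * pairing Y2 b); last by ring.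
    by rewrite area0' subrr mul0r.
  - apply: (mulIf (lt0r_neq0 s0)); rewrite mul0r !pairingE.
    rewrite (_ : _ * s = pairing Y1 b * s - (t * s) * pairing Y2 b); last by ring.
    rewrite ts sE.
    rewrite (_ : _ - _ = (pairing Y1 b * pairing Y2 a - pairing Y1 a * pairing Y2 b) * pairing Y2 a); last by ring.
    by rewrite area0' subrr mul0r.
  - suff -> : pairing (Y1 - t *: Y2) (Y1 - t *: Y2) = 0 by [].
    by rewrite !pairingE !real_lat_form !Viso // !mulr0z; ring.
have [i [j /eqP]] := free_minor free; apply; apply/eqP; rewrite -(intr_eq0 R).
have e k : (y.1 k 0)%:~R = t * (y.2 k 0)%:~R :> R.
  by move/eqP: Y12; rewrite subr_eq0 => /eqP/colP/(_ k); rewrite !mxE.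
by rewrite !(rmorphD, rmorphN, rmorphM) /= !e; apply/eqP; ring.
Qed.

Lemma Zbasis_swap V y : Zbasis V y -> Zbasis V (y.2, y.1).
Proof.
move=> [Vy free]; split=> [|a b /=]; last first.
  by rewrite addrC => /free[].
rewrite Vy; apply/seteqP; split=> _ [a _ [b _ <-]] /=.
  by exists b => //; exists a => //; rewrite addrC.
by exists b => //; exists a => //; rewrite addrC.
Qed.

Lemma area_swap w y : area w (y.2, y.1) = - area w y.
Proof. by rewrite /area /plane_det /=; ring. Qed.

Lemma oriented_basis V w : primitive_isotropic_rank2 V -> period_vector w ->
  exists y, Zbasis V y /\ 0 < area w y.
Proof.
move=> [_ [y yb] _ Viso] pw; have := area_period_neq0 Viso yb pw.
rewrite neq_lt => /orP[] lt0; last by exists y.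
exists (y.2, y.1); split; first exact: Zbasis_swap.
by rewrite area_swap oppr_gt0.
Qed.

Lemma Zbasis_comb V y (m n : int) p q : Zbasis V y -> V p -> V q -> V (m *: p + n *: q).
Proof.
move=> [-> _] [a _ [b _ <-]] [c _ [d _ <-]].
exists (m * a + n * c) => //; exists (m * b + n * d) => //.
by rewrite !scalerDl !scalerDr !scalerA addrACA.
Qed.

Lemma Zbasis_SL2 V y (m : 'M[int]_2) : Zbasis V y -> \det m = 1 ->
  Zbasis V (m 0 0 *: y.1 + m 0 1 *: y.2, m 1 0 *: y.1 + m 1 1 *: y.2).
Proof.
rewrite det_mx2; move: (m 0 0) (m 0 1) (m 1 0) (m 1 1) => a b c d yb dm.
have [Vy free] := yb; have [y1 y2] := Zbasis_mem yb; split=> [|k l /=].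
  apply/seteqP; split; last first.
    by move=> _ [k _ [l _ <-]]; apply: (Zbasis_comb _ _ yb); exact: (Zbasis_comb _ _ yb).
  rewrite {1}Vy => _ [k _ [l _ <-]] /=.
  exists (k * d - l * c) => //; exists (l * a - k * b) => //.
  transitivity ((k * (a * d - b * c)) *: y.1 + (l * (a * d - b * c)) *: y.2).
    by apply/colP => i; rewrite !mxE; ring.
  by rewrite dm !mulr1.
move=> e; have [] := free (k * a + l * c) (k * b + l * d).
  by rewrite -[RHS]e; apply/colP => i; rewrite !mxE; ring.
move=> e1 e2; split.
  transitivity (k * (a * d - b * c)); first by rewrite dm mulr1.
  transitivity ((k * a + l * c) * d - (k * b + l * d) * c); first by ring.
  by rewrite e1 e2 !mul0r subrr.
transitivity (l * (a * d - b * c)); first by rewrite dm mulr1.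
transitivity ((k * b + l * d) * a - (k * a + l * c) * b); first by ring.
by rewrite e1 e2 !mul0r subrr.
Qed.

Lemma calV_pE (Op : set (proj_space R)) V x w y :
  spans w x -> Zbasis V y -> 0 < area w y ->
  calV_p Op V x = (Op x /\
    Num.max (rho (vratio w y)) (2 / Num.sqrt 3) < herm w / (4 * area w y)).
Proof. by rewrite /calV_p => sw yb y0; have [/= -> ->] := invariantsE sw yb y0. Qed.

(** A basis with [1 / u2 < Im tau < u2] satisfies the two bounds under which
    integral isotropic vectors have to be orthogonal. *)
Lemma short_basis (Op : set (proj_space R)) V x w :
  Op `<=` @Omega R -> primitive_isotropic_rank2 V -> calV_p Op V x -> spans w x ->
  exists y, [/\ Zbasis V y,
    2 * plane_sq (vre w) (vim w) (real_vec R y.2) < pairing (vre w) (vre w) &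
    2 * area w y ^+ 2 <
      pairing (vre w) (vre w) * plane_sq (vre w) (vim w) (real_vec R y.2)].
Proof.
move=> OpO Vp cx sw; have Ox : Omega x by apply: OpO; case: cx.
have pw : period_vector w by apply/(period_vector_spans sw).
have [y0 [yb0 y00]] := oriented_basis Vp pw.
move: cx; rewrite (calV_pE _ sw yb0 y00) gt_max => -[_ /andP[u_rho u_s]].
have t0 := Im_vratio_gt0 y00.
have hE : herm w = 2 * pairing (vre w) (vre w).
  by rewrite /herm; case: pw => -> _ _; ring.
set p := pairing _ _ in hE *; rewrite hE in u_rho u_s.
have p0 : 0 < p by case: pw.
set A := area w y0 in y00 u_rho u_s t0.
have uE : 2 * p / (4 * A) = p / (2 * A) by field; rewrite gt_eqF.
rewrite uE in u_rho u_s; set u := p / (2 * A) in u_rho u_s.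
(* [u] is the value of [u2]; since [u > 2 / sqrt 3], some basis has
   [u^-1 < Im tau], and [Im tau < u] holds for all of them. *)
have u0 : 0 < u by rewrite divr_gt0 ?mulr_gt0.
have uA : u * (2 * A) = p by rewrite divfK // gt_eqF // mulr_gt0.
have s3 : Num.sqrt 3 ^+ 2 = 3 :> R by rewrite sqr_sqrtr.
have s30 : 0 < Num.sqrt 3 :> R by rewrite sqrtr_gt0.
have u43 : 4 < 3 * u ^+ 2.
  have : 2 < u * Num.sqrt 3 by rewrite -ltr_pdivrMr.
  rewrite -ltr_sqr ?nnegrE //; last by rewrite mulr_ge0 // ltW.
  by rewrite exprMn s3; lra.
have uV : 0 < u^-1 by rewrite invr_gt0.
have uuV : u * u^-1 = 1 by rewrite divff // gt_eqF.
have [m dm lt_m] : exists2 m, \det m = 1 & u^-1 < complex.Im (mobius m (vratio w y0)).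
  apply: (mobius_Im_gt t0 uV); rewrite exprVn.
  have u2 : 0 < u ^+ 2 by rewrite exprn_gt0.
  rewrite -(ltr_pM2r u2) mulVf ?lt0r_neq0 //; lra.
have lt_M : complex.Im (mobius m (vratio w y0)) < u.
  by apply: le_lt_trans u_rho; apply: Im_mobius_le_rho.
pose y : lattice * lattice :=
  (m 0 0 *: y0.1 + m 0 1 *: y0.2, m 1 0 *: y0.1 + m 1 1 *: y0.2).
have AE : area w y = A by rewrite (area_change w (erefl y.1) (erefl y.2)) dm mulr1z mul1r.
have Z20 : C_form w (to_C R y0.2) != 0 by apply: area_neq0; exact: lt0r_neq0 y00.
have y2_gt0 : 0 < plane_sq (vre w) (vim w) (real_vec R y.2).
  rewrite -abs2_C_form abs2_gt0; apply: area_neq0; rewrite AE; exact: lt0r_neq0 y00.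
have ImE : complex.Im (mobius m (vratio w y0)) = A / plane_sq (vre w) (vim w) (real_vec R y.2).
  by rewrite -(vratio_change (z := y) (erefl _) (erefl _) Z20) Im_vratio AE abs2_C_form.
exists y; split; first exact: Zbasis_SL2.
- move: lt_m; rewrite ImE ltr_pdivlMr // mulrC ltr_pdivrMr // => h.
  rewrite -uA; apply: (@lt_le_trans _ _ (2 * (A * u))); first by rewrite ltr_pM2l.
  by rewrite le_eqVlt; apply/orP; left; apply/eqP; ring.
move: lt_M; rewrite ImE ltr_pdivrMr // => h.
rewrite AE -uA (_ : 2 * A ^+ 2 = 2 * A * A); last by ring.
rewrite (_ : u * _ * _ = 2 * A * (u * plane_sq (vre w) (vim w) (real_vec R y.2))); last by ring.
by rewrite ltr_pM2l // mulr_gt0.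
Qed.

(** The short bases of two planes are orthogonal to each other, and a maximal
    isotropic subspace is its own orthogonal; this expresses [f] over the reals,
    and Cramer's rule makes the relation integral. *)
Lemma short_planes_span w y z :
  (forall m n : int, m *: z.1 + n *: z.2 = 0 -> m = 0 /\ n = 0) ->
  period_vector w ->
  (forall a b, a \in [:: y.1; y.2] -> b \in [:: y.1; y.2] -> lat_form a b = 0) ->
  (forall a b, a \in [:: z.1; z.2] -> b \in [:: z.1; z.2] -> lat_form a b = 0) ->
  let p := pairing (vre w) (vre w) in
  let sq f := plane_sq (vre w) (vim w) (real_vec R f) in
  2 * sq y.2 < p -> 2 * area w y ^+ 2 < p * sq y.2 ->
  2 * sq z.2 < p -> 2 * area w z ^+ 2 < p * sq z.2 -> area w z != 0 ->
  forall f, f \in [:: y.1; y.2] ->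
  exists k m n : int, k != 0 /\ k *: f = m *: z.1 + n *: z.2.
Proof.
move=> free pw yy zz p sq ys ya zs za az f fy; have [ab aob a0] := pw.
have m1 (u : lattice * lattice) : u.1 \in [:: u.1; u.2] by rewrite !inE eqxx.
have m2 (u : lattice * lattice) : u.2 \in [:: u.1; u.2] by rewrite !inE eqxx orbT.
have iso0 (a b : lattice) : lat_form a b = 0 -> pairing (real_vec R a) (real_vec R b) = 0.
  by rewrite real_lat_form => ->; rewrite mulr0z.
have zint u v : u \in [:: real_vec R y.1; real_vec R y.2] ->
    v \in [:: real_vec R z.1; real_vec R z.2] ->
    exists n : int, pairing u v = n%:~R.
  by rewrite !inE => /orP[] /eqP -> /orP[] /eqP ->;
     rewrite real_lat_form; eexists.
have [e11 e12 e21 e22] := reduced_planes_orth a0 erefl (esym ab) aob zint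
  (iso0 _ _ (yy _ _ (m1 y) (m1 y))) (iso0 _ _ (yy _ _ (m1 y) (m2 y)))
  (iso0 _ _ (yy _ _ (m2 y) (m2 y))) (iso0 _ _ (zz _ _ (m1 z) (m1 z)))
  (iso0 _ _ (zz _ _ (m1 z) (m2 z))) (iso0 _ _ (zz _ _ (m2 z) (m2 z)))
  ys zs ya za.
have f1 : pairing (real_vec R f) (real_vec R z.1) = 0.
  by move: fy; rewrite !inE => /orP[] /eqP ->.
have f2 : pairing (real_vec R f) (real_vec R z.2) = 0.
  by move: fy; rewrite !inE => /orP[] /eqP ->.
have [c [d fE]] := isotropic_span a0 erefl (esym ab) aob
  (iso0 _ _ (zz _ _ (m1 z) (m1 z))) (iso0 _ _ (zz _ _ (m1 z) (m2 z)))
  (iso0 _ _ (zz _ _ (m2 z) (m2 z))) (iso0 _ _ (yy _ _ fy fy)) f1 f2 az.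
exact: (integral_relation free fE).
Qed.

End Isotropic.

Section Isometries.
Variable R : realType.
Implicit Types (w : 'cV[R[i]]_20) (x : proj_space R) (V : set lattice)
  (g : 'M[int]_20) (y z : lattice * lattice).

(** In matrix form the isometry condition extends to all rings of scalars. *)
Lemma isometry_gram g : isometries g -> g^T *m L_gram *m g = L_gram.
Proof.
move=> [_ gi]; apply/matrixP => i j.
have E (M : 'M[int]_20) : M i j = ((delta_mx i 0 : lattice)^T *m M *m (delta_mx j 0 : lattice)) 0 0.
  by rewrite trmx_delta -rowE -colE !mxE.
rewrite [LHS]E [RHS]E; have := gi (delta_mx i 0) (delta_mx j 0).
by rewrite /lat_form trmx_mul !mulmxA.
Qed.

Lemma pairing_isometry (T : comNzRingType) g (u v : 'cV[T]_20) : isometries g ->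
  pairing (map_mx intr g *m u) (map_mx intr g *m v) = pairing u v.
Proof.
move=> /isometry_gram gi; with_strategy transparent [pairing] rewrite /pairing.
by rewrite -[in RHS]gi !map_mxM trmx_mul matrix.map_trmx !mulmxA.
Qed.

Lemma C_form_isometry g w (a : lattice) : isometries g ->
  C_form (to_C R g *m w) (to_C R (g *m a)) = C_form w (to_C R a).
Proof. by move=> gi; rewrite !C_formE /to_C map_mxM pairing_isometry. Qed.

Lemma conj_vec_mul g w : conj_vec (to_C R g *m w) = to_C R g *m conj_vec w.
Proof.
rewrite /conj_vec map_mxM; congr (_ *m _).
by apply/matrixP => i j; rewrite !mxE rmorph_int.
Qed.

Lemma herm_isometry g w : isometries g -> herm (to_C R g *m w) = herm w.
Proof.
move=> gi; have := pairing_conj (to_C R g *m w).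
by rewrite conj_vec_mul pairing_isometry // pairing_conj => -[].
Qed.

Lemma period_vector_isometry g w : isometries g ->
  period_vector (to_C R g *m w) <-> period_vector w.
Proof. by move=> gi; rewrite !period_vectorP herm_isometry // pairing_isometry. Qed.

Lemma area_C_form w y :
  area w y = complex.Im (C_form w (to_C R y.1) * (C_form w (to_C R y.2))^*).
Proof. by rewrite !C_form_lat /area /plane_det /=; ring. Qed.

Lemma area_isometry g w y : isometries g ->
  area (to_C R g *m w) (g *m y.1, g *m y.2) = area w y.
Proof. by move=> gi; rewrite !area_C_form !C_form_isometry. Qed.

Lemma vratio_isometry g w y : isometries g ->
  vratio (to_C R g *m w) (g *m y.1, g *m y.2) = vratio w y.
Proof. by move=> gi; rewrite /vratio !C_form_isometry. Qed.

Lemma isometry_neq0 g w : isometries g -> w != 0 -> to_C R g *m w != 0.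
Proof.
move=> [gu _]; apply: contra => /eqP e.
have gU : to_C R g \in unitmx by move: gu; rewrite !unitmxE det_map_mx; exact: rmorph_unit.
by rewrite -(mulKmx gU w) e mulmx0.
Qed.

Lemma spans_lat_act g w x : isometries g -> spans w x ->
  spans (to_C R g *m w) (lat_act g x).
Proof.
by move=> gi sw; apply: spans_act => //; apply: isometry_neq0 => //; exact: spans_neq0 sw.
Qed.

Lemma Zbasis_stabilizer g V y : stabilizer V g -> Zbasis V y ->
  Zbasis V (g *m y.1, g *m y.2).
Proof.
move=> [[gu _] gV] [Vy free]; split=> [|m n /=].
  rewrite -[LHS]gV; apply/seteqP; split.
    move=> _ [v + <-]; rewrite Vy => -[a _ [b _ <-]].
    by exists a => //; exists b => //; rewrite mulmxDr -!scalemxAr.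
  move=> _ [a _ [b _ <-]]; exists (a *: y.1 + b *: y.2).
    by rewrite Vy; exists a => //; exists b.
  by rewrite mulmxDr -!scalemxAr.
rewrite !scalemxAr -mulmxDr => e; apply: free.
by rewrite -(mulKmx gu (m *: _ + _)) e mulmx0.
Qed.

Lemma calV_p_act (Op : set (proj_space R)) V x g : Op `<=` @Omega R ->
  primitive_isotropic_rank2 V -> stabilizer V g -> Op x -> Op (lat_act g x) ->
  calV_p Op V (lat_act g x) <-> calV_p Op V x.
Proof.
move=> OpO Vp sg Ox Ogx; have [gi _] := sg.
have sw := spans_self x.
have pw : period_vector (spanning x) by apply/(period_vector_spans sw)/OpO.
have [y [yb y0]] := oriented_basis Vp pw.
rewrite (calV_pE _ sw yb y0).
rewrite (calV_pE _ (spans_lat_act gi sw) (Zbasis_stabilizer sg yb)); last first.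
  by rewrite area_isometry.
rewrite (herm_isometry _ gi) (area_isometry _ _ gi) (vratio_isometry _ _ gi).
by split=> -[_ lt]; split; [exact: Ox | exact: lt | exact: Ogx | exact: lt].
Qed.

(** At the image point both V and its image under [g] have a short basis, so the
    two planes have the same rational span; primitivity makes them equal. *)
Lemma stabilizer_of_short_points (Op : set (proj_space R)) V x g :
  Op `<=` @Omega R -> primitive_isotropic_rank2 V -> isometries g ->
  calV_p Op V x -> calV_p Op V (lat_act g x) -> stabilizer V g.
Proof.
move=> OpO Vp gi cx cgx; have [_ _ Vprim Viso] := Vp.
have sw := spans_self x; have sgw := spans_lat_act gi sw.
have pgw : period_vector (to_C R g *m spanning x).
  by apply/(period_vector_spans sgw)/OpO; case: cgx.
have [y [yb ys ya]] := short_basis OpO Vp cx sw.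
have [z [zb zs za]] := short_basis OpO Vp cgx sgw.
have [y1 y2] := Zbasis_mem yb; have [z1 z2] := Zbasis_mem zb.
set w := spanning x in sw sgw pgw ys ya zs za *.
set gw := to_C R g *m w in sgw pgw zs za *.
pose gy : lattice * lattice := (g *m y.1, g *m y.2).
have pE : pairing (vre gw) (vre gw) = pairing (vre w) (vre w).
  have [e _ _] := pgw; have /(period_vector_isometry _ gi) [e' _ _] := pgw.
  have := herm_isometry w gi; rewrite -/gw /herm -e -e'; lra.
have sqE (a : lattice) : plane_sq (vre gw) (vim gw) (real_vec R (g *m a)) =
    plane_sq (vre w) (vim w) (real_vec R a).
  by rewrite -!abs2_C_form C_form_isometry.
have gyiso (a b : lattice) : a \in [:: gy.1; gy.2] -> b \in [:: gy.1; gy.2] ->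
    lat_form a b = 0.
  by rewrite !inE => /orP[] /eqP -> /orP[] /eqP ->; rewrite gi.2 Viso.
have ziso (a b : lattice) : a \in [:: z.1; z.2] -> b \in [:: z.1; z.2] ->
    lat_form a b = 0.
  by rewrite !inE => /orP[] /eqP -> /orP[] /eqP ->; rewrite Viso.
have gys : 2 * plane_sq (vre gw) (vim gw) (real_vec R gy.2) < pairing (vre gw) (vre gw).
  by rewrite pE sqE.
have gya : 2 * area gw gy ^+ 2 <
    pairing (vre gw) (vre gw) * plane_sq (vre gw) (vim gw) (real_vec R gy.2).
  by rewrite pE sqE area_isometry.
have pw : period_vector w by exact: (period_vector_isometry w gi).1 pgw.
have az := area_period_neq0 Viso zb pgw.
have ay : area gw gy != 0 by rewrite area_isometry //; exact: area_period_neq0 Viso yb pw.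
have [gu _] := gi.
have gyfree (m n : int) : m *: gy.1 + n *: gy.2 = 0 -> m = 0 /\ n = 0.
  rewrite /= !scalemxAr -mulmxDr => e; apply: yb.2.
  by rewrite -(mulKmx gu (m *: _ + _)) e mulmx0.
have inV f : f \in [:: gy.1; gy.2] -> V f.
  move=> fy; have [k [m [n [k0 kf]]]] :=
    short_planes_span zb.2 pgw gyiso ziso gys gya zs za az fy.
  by apply: (Vprim k) => //; rewrite kf; exact: Zbasis_comb zb z1 z2.
have ing f : f \in [:: z.1; z.2] -> V (invmx g *m f).
  move=> fz; have [k [m [n [k0 kf]]]] :=
    short_planes_span gyfree pgw ziso gyiso zs za gys gya ay fz.
  apply: (Vprim k) => //; rewrite scalemxAr kf mulmxDr -!scalemxAr !mulKmx //.
  exact: Zbasis_comb yb y1 y2.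
split=> //; apply/seteqP; split.
  move=> _ [v + <-]; rewrite {1}yb.1 => -[a _ [b _ <-]].
  rewrite mulmxDr -!scalemxAr; apply: (Zbasis_comb _ _ yb); apply: inV.
    by rewrite !inE eqxx.
  by rewrite !inE eqxx orbT.
move=> v; rewrite {1}zb.1 => -[a _ [b _ <-]].
exists (a *: (invmx g *m z.1) + b *: (invmx g *m z.2)).
  apply: (Zbasis_comb _ _ yb); apply: ing.
    by rewrite !inE eqxx.
  by rewrite !inE eqxx orbT.
by rewrite mulmxDr -!scalemxAr !mulKVmx.
Qed.

End Isometries.

(** * Continuity in the complex vector space *)

Section Topology.
Variable R : realType.

Lemma nbhs_complexP (z : R[i]) (A : set R[i]) :
  nbhs z A <-> exists2 r : R, 0 < r & forall t, `|z - t| < r%:C -> A t.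
Proof.
split=> [/nbhs_normP[e /= e0 eA]|[r r0 rA]]; last first.
  by apply/nbhs_normP; exists r%:C => //=; rewrite ltcR.
have eE : e = (complex.Re e)%:C by rewrite RRe_real // gtr0_real.
by exists (complex.Re e); rewrite -?ltcR -eE.
Qed.

Lemma Re_continuous : continuous (@complex.Re R : R[i] -> R).
Proof.
move=> z A /nbhs_normP[r /= r0 rA]; apply/nbhs_complexP; exists r => // t zt.
apply: rA => /=; rewrite -ltcR; apply: le_lt_trans zt.
by apply: le_trans (normc_ge_Re _); rewrite raddfB.
Qed.

Lemma Im_continuous : continuous (@complex.Im R : R[i] -> R).
Proof.
move=> z A /nbhs_normP[r /= r0 rA]; apply/nbhs_complexP; exists r => // t zt.
apply: rA => /=; rewrite -ltcR; apply: le_lt_trans zt.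
have : `|z - t| = `|(z - t) * - 'i|.
  rewrite normrM normrN (_ : `|'i| = 1) ?mulr1 //.
  by apply/eqP; rewrite normc_def /= expr0n expr1n add0r sqrtr1.
move=> ->; apply: le_trans (normc_ge_Re _).
by rewrite mulrN raddfN /= ReiNIm opprK raddfB.
Qed.

Lemma Complex_continuous (T : topologicalType) (f g : T -> R) :
  continuous f -> continuous g -> continuous (fun t => f t +i* g t : R[i]).
Proof.
move=> cf cg t A /nbhs_complexP[r r0 rA].
have r2 : 0 < r / 2 by rewrite divr_gt0.
have nf : \forall s \near t, `|f t - f s| < r / 2.
  exact: (cvgr_dist_lt _ _ (cf t) _ r2).
have ng : \forall s \near t, `|g t - g s| < r / 2.
  exact: (cvgr_dist_lt _ _ (cg t) _ r2).
suff : \forall s \near t, A (f s +i* g s) by [].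
near=> s; apply: rA; have fs : `|f t - f s| < r / 2 by near: s.
have gs : `|g t - g s| < r / 2 by near: s.
rewrite (_ : _ - _ = (f t - f s)%:C + (g t - g s)%:C * 'i); last first.
  by apply/eqP; rewrite eq_complex /=; apply/andP; split; apply/eqP; ring.
apply: le_lt_trans (ler_normD _ _) _; rewrite normrM.
rewrite (_ : `|'i| = 1 :> R[i]) ?mulr1; last first.
  by apply/eqP; rewrite normc_def /= expr0n expr1n add0r sqrtr1.
have E (a : R) : `|a%:C| = `|a|%:C :> R[i].
  by rewrite normc_def /= expr0n addr0 sqrtr_sqr.
by rewrite !E -rmorphD ltcR (splitr r) ltrD.
Unshelve. all: by end_near. Qed.

Lemma matrix_continuous (T U : topologicalType) m n (f : T -> 'M[U]_(m, n)) :
  (forall i j, continuous (fun t => f t i j)) -> continuous f.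
Proof.
move=> cf t A [P Pn PA]; near=> s; apply: PA => i j.
by move: i j; near: s; do 2 (apply: filter_forall => ?); exact: cf.
Unshelve. all: by end_near. Qed.

Lemma entry_continuous (U : topologicalType) m n (i : 'I_m) (j : 'I_n) :
  continuous (fun M : 'M[U]_(m, n) => M i j).
Proof.
move=> M A MA; exists (fun i' j' => if (i' == i) && (j' == j) then A else setT).
  by move=> i' j'; case: ifP => [/andP[/eqP -> /eqP ->] //|_]; exact: filterT.
by move=> M' /(_ i j); rewrite !eqxx.
Qed.

(** Continuity of a complex function, on its real and imaginary parts: this
    form is stable under all ring operations by the real results. *)
Definition ccontinuous (T : topologicalType) (f : T -> R[i]) :=
  continuous (fun t => complex.Re (f t)) /\ continuous (fun t => complex.Im (f t)).

Section CContinuous.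
Variable T : topologicalType.
Implicit Types f g : T -> R[i].

Lemma ccontinuousP f : ccontinuous f -> continuous f.
Proof.
move=> [fr fi]; rewrite (_ : f = fun t => complex.Re (f t) +i* complex.Im (f t)).
  exact: Complex_continuous.
by apply/funext => t; case: (f t).
Qed.

Lemma ccontinuous_cst c : ccontinuous (fun _ : T => c).
Proof. by split=> t; exact: cvg_cst. Qed.

Lemma ccontinuous_real (f : T -> R) : continuous f -> ccontinuous (fun t => (f t)%:C).
Proof. by move=> cf; split=> [//|t]; exact: cvg_cst. Qed.

Lemma ccontinuousD f g : ccontinuous f -> ccontinuous g ->
  ccontinuous (fun t => f t + g t).
Proof.
move=> [fr fi] [gr gi]; split=> t.
  rewrite (_ : (fun t => _) = (fun t => complex.Re (f t) + complex.Re (g t))).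
    by apply: cvgD; [exact: fr | exact: gr].
  by apply/funext => s; case: (f s) (g s) => ? ? [].
rewrite (_ : (fun t => _) = (fun t => complex.Im (f t) + complex.Im (g t))).
  by apply: cvgD; [exact: fi | exact: gi].
by apply/funext => s; case: (f s) (g s) => ? ? [].
Qed.

Lemma ccontinuousM f g : ccontinuous f -> ccontinuous g ->
  ccontinuous (fun t => f t * g t).
Proof.
move=> [fr fi] [gr gi]; split=> t.
  rewrite (_ : (fun t => _) = (fun t => complex.Re (f t) * complex.Re (g t) -
     complex.Im (f t) * complex.Im (g t))).
    by apply: cvgB; apply: cvgM; [exact: fr | exact: gr | exact: fi | exact: gi].
  by apply/funext => s; rewrite ReZ.
rewrite (_ : (fun t => _) = (fun t => complex.Re (f t) * complex.Im (g t) +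
    complex.Im (f t) * complex.Re (g t))).
  by apply: cvgD; apply: cvgM; [exact: fr | exact: gi | exact: fi | exact: gr].
by apply/funext => s; rewrite ImZ.
Qed.

Lemma ccontinuous_sum (I : finType) (F : I -> T -> R[i]) :
  (forall k, ccontinuous (F k)) -> ccontinuous (fun t => \sum_k F k t).
Proof.
move=> cF; elim: (index_enum I) => [|k s IHs].
  rewrite (_ : (fun t => _) = (fun _ => 0)); first exact: ccontinuous_cst.
  by apply/funext => t; rewrite big_nil.
rewrite (_ : (fun t => _) = (fun t => F k t + \sum_(j <- s) F j t)).
  exact: ccontinuousD.
by apply/funext => t; rewrite big_cons.
Qed.

Lemma ccontinuous_conj f : ccontinuous f -> ccontinuous (fun t => (f t)^*).
Proof.
move=> [fr fi]; split=> t.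
  rewrite (_ : (fun t => _) = (fun t => complex.Re (f t))); first exact: fr.
  by apply/funext => s; case: (f s).
rewrite (_ : (fun t => _) = (fun t => - complex.Im (f t))); first by apply: cvgN; exact: fi.
by apply/funext => s; case: (f s).
Qed.

Definition vcontinuous (f : T -> 'cV[R[i]]_20) := forall k, ccontinuous (fun t => f t k 0).

Implicit Types u v : T -> 'cV[R[i]]_20.

Lemma vcontinuousP u : vcontinuous u -> continuous u.
Proof.
by move=> cu; apply: matrix_continuous => i j; rewrite ord1; exact/ccontinuousP/cu.
Qed.

Lemma vcontinuous_cst w : vcontinuous (fun=> w).
Proof. by move=> k; exact: ccontinuous_cst. Qed.

Lemma vcontinuousD u v : vcontinuous u -> vcontinuous v -> vcontinuous (fun t => u t + v t).
Proof.
move=> cu cv k; rewrite (_ : (fun t => _) = (fun t => u t k 0 + v t k 0)).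
  exact: ccontinuousD.
by apply/funext => t; rewrite mxE.
Qed.

Lemma vcontinuousZ f u : ccontinuous f -> vcontinuous u ->
  vcontinuous (fun t => f t *: u t).
Proof.
move=> cf cu k; rewrite (_ : (fun t => _) = (fun t => f t * u t k 0)).
  exact: ccontinuousM.
by apply/funext => t; rewrite mxE.
Qed.

Lemma ccontinuous_pairing u v : vcontinuous u -> vcontinuous v ->
  ccontinuous (fun t => pairing (u t) (v t)).
Proof.
move=> cu cv; rewrite (_ : (fun t => _) = (fun t => \sum_j (\sum_k
    u t k 0 * (map_mx intr L_gram : 'M[R[i]]_20) k j) * v t j 0)).
  apply: ccontinuous_sum => j; apply: ccontinuousM; last exact: cv.
  apply: ccontinuous_sum => k; apply: ccontinuousM; first exact: cu.
  exact: ccontinuous_cst.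
apply/funext => t; with_strategy transparent [pairing] rewrite /pairing mxE.
by apply: eq_bigr => j _; rewrite mxE; congr (_ * _); apply: eq_bigr => k _; rewrite mxE.
Qed.

Lemma continuous_herm u : vcontinuous u -> continuous (fun t => herm (u t)).
Proof.
move=> cu; rewrite (_ : (fun t => _) =
    (fun t => complex.Re (pairing (u t) (conj_vec (u t))))).
  apply: (ccontinuous_pairing cu _).1 => k.
  rewrite (_ : (fun t => _) = (fun t => (u t k 0)^*)); first exact: ccontinuous_conj.
  by apply/funext => t; rewrite mxE.
by apply/funext => t; rewrite pairing_conj.
Qed.

Lemma ccontinuous_C_form u (a : lattice) : vcontinuous u ->
  ccontinuous (fun t => C_form (u t) (to_C R a)).
Proof.
move=> cu; rewrite (_ : (fun t => _) = (fun t => pairing (u t) (to_C R a))).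
  by apply: ccontinuous_pairing => //; exact: vcontinuous_cst.
by apply/funext => t; rewrite C_formE.
Qed.

Lemma continuous_area u y : vcontinuous u -> continuous (fun t => area (u t) y).
Proof.
move=> cu; rewrite (_ : (fun t => _) = (fun t => complex.Im
    (C_form (u t) (to_C R y.1) * (C_form (u t) (to_C R y.2))^*))).
  apply: (ccontinuousM _ _).2; first exact: ccontinuous_C_form.
  by apply: ccontinuous_conj; exact: ccontinuous_C_form.
by apply/funext => t; rewrite area_C_form.
Qed.

Lemma continuous_subr (f g : T -> R) : continuous f -> continuous g ->
  continuous (fun t => f t - g t).
Proof. by move=> cf cg t; apply: cvgB; [exact: cf | exact: cg]. Qed.

Lemma continuous_mull (c : R) (f : T -> R) : continuous f ->
  continuous (fun t => c * f t).
Proof. by move=> cf t; apply: cvgM; [exact: cvg_cst | exact: cf]. Qed.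

Lemma continuous_abs2 f : ccontinuous f -> continuous (fun t => abs2 (f t)).
Proof.
move=> [fr fi] t; rewrite /abs2; apply: cvgD.
  by rewrite expr2; apply: cvgM; exact: fr.
by apply: cvgM; exact: fi.
Qed.

End CContinuous.

Lemma vcontinuous_id : vcontinuous (fun w : 'cV[R[i]]_20 => w).
Proof.
move=> k; split=> w.
  apply: (@continuous_comp _ _ _ (fun w : 'cV[R[i]]_20 => w k 0) (@complex.Re R)).
    exact: entry_continuous.
  exact: Re_continuous.
apply: (@continuous_comp _ _ _ (fun w : 'cV[R[i]]_20 => w k 0) (@complex.Im R)).
  exact: entry_continuous.
exact: Im_continuous.
Qed.

Lemma proj_pt_continuous (T : topologicalType) (u : T -> 'cV[R[i]]_20)
    (u0 : forall t, u t != 0) :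
  continuous u -> continuous (fun t => proj_pt (u0 t)).
Proof.
move=> cu; pose h t : @nonzero_vectors R :=
  SigSub (mem_set (u0 t) : u t \in @nonzero_vectors R).
have ch : continuous h.
  by apply: continuous_comp_initial; exact: cu.
pose pr (v : @nonzero_vectors R) : proj_space R := \pi_{eq_quot (@collinear R)} v.
have cpr : continuous pr by exact: pi_continuous.
have : continuous (pr \o h).
  by move=> t; apply: continuous_comp; [exact: ch | exact: cpr].
exact.
Qed.

End Topology.

(** * Components of the period domain *)

Section Tilt.
Variable R : realType.
Variable y : lattice * lattice.
Hypothesis iso : [/\ lat_form y.1 y.1 = 0, lat_form y.1 y.2 = 0 & lat_form y.2 y.2 = 0].
Implicit Types (v w : 'cV[R[i]]_20) (T : R).

Let e1 := to_C R y.1.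
Let e2 := to_C R y.2.
Let e11 : pairing e1 e1 = 0. Proof. by rewrite -lat_formE; case: iso => -> _ _. Qed.
Let e12 : pairing e1 e2 = 0. Proof. by rewrite -lat_formE; case: iso => _ -> _. Qed.
Let e21 : pairing e2 e1 = 0. Proof. by rewrite pairingC e12. Qed.
Let e22 : pairing e2 e2 = 0. Proof. by rewrite -lat_formE; case: iso => _ _ ->. Qed.

(** The action of [exp (- i T N)], where [N] is the nilpotent endomorphism
    [v |-> <v, y.1> y.2 - <v, y.2> y.1]: it preserves the quadric and the periods
    of [y], and increases [herm] at a rate proportional to the area. *)
Definition tilt T v := v - ('i * T%:C) *: (C_form v e1 *: e2 - C_form v e2 *: e1).

Lemma pairing_tilt T v : pairing (tilt T v) (tilt T v) = pairing v v.
Proof.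
rewrite /tilt !C_formE !pairingE e11 e12 e21 e22 !(pairingC _ v).
move: (pairing v v) (pairing v e1) (pairing v e2) ('i * _) => a b c d; ring.
Qed.

Lemma C_form_tilt2 T v : C_form (tilt T v) e2 = C_form v e2.
Proof. by rewrite /tilt !C_formE !pairingE e12 e22 !mulr0 oppr0 addr0 mulr0 oppr0 addr0. Qed.

Lemma conj_vecD v w : conj_vec (v + w) = conj_vec v + conj_vec w.
Proof. by apply/colP => k; rewrite !mxE rmorphD. Qed.

Lemma conj_vecZ (c : R[i]) v : conj_vec (c *: v) = c^* *: conj_vec v.
Proof. by apply/colP => k; rewrite !mxE rmorphM. Qed.

Lemma conj_vec_comb (a b c : R[i]) v p q : conj_vec p = p -> conj_vec q = q ->
  conj_vec (v + a *: (b *: p + c *: q)) =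
  conj_vec v + a^* *: (b^* *: p + c^* *: q).
Proof. by move=> ep eq; rewrite conj_vecD conj_vecZ conj_vecD !conj_vecZ ep eq. Qed.

Lemma conj_vec_to_C (a : lattice) : conj_vec (to_C R a) = to_C R a.
Proof. by apply/colP => k; rewrite !mxE rmorph_int. Qed.

Lemma pairing_conj_lat v (a : lattice) :
  pairing (conj_vec v) (to_C R a) = (pairing v (to_C R a))^*.
Proof. by rewrite -{1}(conj_vec_to_C a) -map_pairing. Qed.

Lemma herm_tilt T v : herm (tilt T v) = herm v + 4 * T * area v y.
Proof.
have tE : tilt T v = v + (- ('i * T%:C)) *: (pairing v e1 *: e2 + (- pairing v e2) *: e1).
  by rewrite /tilt !C_formE !scaleNr.
have cE : conj_vec (tilt T v) = conj_vec v + (- ('i * T%:C))^* *: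
    ((pairing v e1)^* *: e2 + (- pairing v e2)^* *: e1).
  by rewrite tE; apply: conj_vec_comb; exact: conj_vec_to_C.
apply: complexI; rewrite -pairing_conj cE tE !pairingE.
rewrite e11 e12 e21 e22 !(pairingC e1) !(pairingC e2) !pairing_conj_lat pairing_conj.
rewrite area_C_form !C_formE -/e1 -/e2.
move: (herm v) (pairing v e1) (pairing v e2) => h [a b] [c d].
by apply/eqP; rewrite eq_complex /=; apply/andP; split; apply/eqP; ring.
Qed.

(** The segment from [w] to [w'] keeps the periods of [y] under control but leaves
    the quadric; a multiple of [y.2] brings it back. It may still violate the
    positivity condition, which is restored by tilting it far enough, the amount
    of tilt being chosen continuous and zero at both ends. *)
Lemma period_path w w' : period_vector w -> period_vector w' ->
  C_form w e2 = 1 -> C_form w' e2 = 1 -> 0 < area w y -> 0 < area w' y ->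
  exists u : R -> 'cV[R[i]]_20, [/\ vcontinuous u, u 0 = w, u 1 = w',
    forall s, C_form (u s) e2 = 1 & forall s, 0 <= s <= 1 -> period_vector (u s)].
Proof.
move=> /period_vectorP[ww hw] /period_vectorP[ww' hw'] w2 w'2 aw aw'.
pose b := pairing w w'; pose q (s : R) := s * (1 - s).
pose v s := (1 - s)%:C *: w + s%:C *: w' - ((q s)%:C * b) *: e2.
(* Area is affine along [v], so the minimum of its end values bounds it below;
   dividing by this constant keeps the path continuous on the whole line. *)
pose M := (4 * Num.min (area w y) (area w' y))^-1.
pose u s := tilt (Num.max 0 (q s - herm (v s)) * M) (v s).
have m0 : 0 < Num.min (area w y) (area w' y) by rewrite lt_min aw.
have v2 s : C_form (v s) e2 = 1.
  rewrite /v !C_formE !pairingE e22 mulr0 oppr0 addr0 -!C_formE w2 w'2 !mulr1.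
  by rewrite -rmorphD subrK.
have vv s : pairing (v s) (v s) = 0.
  rewrite /v !pairingE e22 ww ww' !(pairingC e2) (pairingC w' w) -/b.
  move: w2 w'2; rewrite !C_formE => -> ->; rewrite /q !rmorphM !rmorphB rmorph1.
  by ring.
have av s : area (v s) y = (1 - s) * area w y + s * area w' y.
  rewrite !area_C_form -/e2 v2 w2 w'2 /v !C_formE !pairingE e21.
  rewrite mulr0 subr0 !rmorph1 !mulr1.
  by move: (pairing w e1) (pairing w' e1) => [? ?] [? ?] /=; ring.
have cq : continuous q.
  move=> s; apply: cvgM; first exact: cvg_id.
  by apply: cvgB; [exact: cvg_cst | exact: cvg_id].
have cv : vcontinuous v.
  apply: vcontinuousD.
    apply: vcontinuousD; apply: vcontinuousZ; try exact: vcontinuous_cst.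
      apply: ccontinuous_real => s; apply: cvgB; [exact: cvg_cst | exact: cvg_id].
    by apply: ccontinuous_real => s; exact: cvg_id.
  rewrite (_ : (fun t => _) = fun t => (-1 * ((q t)%:C * b)) *: e2).
    apply: vcontinuousZ; last exact: vcontinuous_cst.
    apply: ccontinuousM; first exact: ccontinuous_cst.
    by apply: ccontinuousM; [exact: ccontinuous_real | exact: ccontinuous_cst].
  by apply/funext => t; rewrite mulN1r scaleNr.
have cT : continuous (fun s => Num.max 0 (q s - herm (v s)) * M).
  move=> s; apply: cvgM; last exact: cvg_cst.
  apply: (@continuous_max _ R (fun _ => 0) (fun s => q s - herm (v s))).
    exact: cvg_cst.
  by apply: cvgB; [exact: cq | exact: continuous_herm].
have cu : vcontinuous u.
  have cZ (a : lattice) : ccontinuous (fun s => C_form (v s) (to_C R a)).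
    exact: ccontinuous_C_form.
  rewrite (_ : u = fun s => v s + (-1 * ('i * (Num.max 0 (q s - herm (v s)) * M)%:C)) *:
      (C_form (v s) e1 *: e2 + (-1 * C_form (v s) e2) *: e1)).
    apply: vcontinuousD => //; apply: vcontinuousZ.
      do 2 (apply: ccontinuousM; first exact: ccontinuous_cst).
      exact: ccontinuous_real.
    apply: vcontinuousD; apply: vcontinuousZ; try exact: vcontinuous_cst.
      exact: cZ.
    by apply: ccontinuousM; [exact: ccontinuous_cst | exact: cZ].
  by apply/funext => t; rewrite /u /tilt !mulN1r !scaleNr.
have v0 : v 0 = w by rewrite /v /q mul0r subr0 mul0r !scale0r scale1r subr0 addr0.
have v1 : v 1 = w'.
  by rewrite /v /q subrr mulr0 mul0r !scale0r scale1r subr0 add0r.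
have tilt0 x : tilt 0 x = x by rewrite /tilt mulr0 scale0r subr0.
exists u; split; first exact: cu.
- rewrite /u v0 /q mul0r sub0r (_ : Num.max _ _ = 0) ?mul0r ?tilt0 //.
  by apply/max_idPl; rewrite oppr_le0 ltW.
- rewrite /u v1 /q subrr mulr0 sub0r (_ : Num.max _ _ = 0) ?mul0r ?tilt0 //.
  by apply/max_idPl; rewrite oppr_le0 ltW.
- by move=> s; rewrite /u C_form_tilt2.
move=> s /andP[s0 s1]; apply/period_vectorP; rewrite /u pairing_tilt herm_tilt.
split; first exact: vv.
have as0 : Num.min (area w y) (area w' y) <= area (v s) y.
  rewrite av; set m := Num.min _ _.
  have -> : m = (1 - s) * m + s * m by ring.
  by rewrite lerD // ler_wpM2l ?subr_ge0 // /m ge_min lexx ?orbT.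
set T := Num.max _ _.
have T0 : 0 <= T by rewrite le_max lexx.
have le1 : T <= 4 * (T * M) * area (v s) y.
  rewrite /M -[leLHS]mulr1 (_ : 4 * _ * _ = T * (area (v s) y / Num.min (area w y) (area w' y))).
    by rewrite ler_wpM2l // ler_pdivlMr // mul1r.
  by field; rewrite lt0r_neq0.
have : q s <= herm (v s) + T.
  have : q s - herm (v s) <= T by rewrite le_max lexx orbT.
  lra.
have : herm (v s) <= herm (v s) + T by lra.
have [q0|qle] := ltP 0 (q s); first lra.
suff : 0 < herm (v s) by clear -T0 le1; lra.
have [->|sn0] := eqVneq s 0; first by rewrite v0.
have [->|sn1] := eqVneq s 1; first by rewrite v1.
have : 0 < q s by rewrite mulr_gt0 ?subr_gt0 // lt_def ?s0 ?s1 ?sn0 // eq_sym sn1.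
by rewrite ltNge qle.
Qed.

End Tilt.

Section Components.
Variable R : realType.
Implicit Types (w : 'cV[R[i]]_20) (x : proj_space R) (V : set lattice)
  (Op : set (proj_space R)).

(** Spanning vectors can be normalized to have second period 1, which keeps the
    path joining them away from zero; its image in projective space is then a
    connected subset of the period domain. *)
Lemma same_component Op y x x' w w' : is_component (@Omega R) Op ->
  [/\ lat_form y.1 y.1 = 0, lat_form y.1 y.2 = 0 & lat_form y.2 y.2 = 0] ->
  spans w x -> spans w' x' -> Op x -> Omega x' ->
  0 < area w y -> 0 < area w' y -> Op x'.
Proof.
move=> [x0 Ox0 OpE] iso sw sw' Opx Ox' aw aw'.
have Ox : Omega x by move: Opx; rewrite OpE; exact: connected_component_sub.
have Z (v : 'cV[R[i]]_20) : 0 < area v y -> C_form v (to_C R y.2) != 0.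
  by move=> av; apply: area_neq0; exact: lt0r_neq0.
have norm1 v : 0 < area v y -> C_form ((C_form v (to_C R y.2))^-1 *: v) (to_C R y.2) = 1.
  by move=> av; rewrite C_formE pairingZl -C_formE mulVf // Z.
have snorm v z : 0 < area v y -> spans v z ->
    spans ((C_form v (to_C R y.2))^-1 *: v) z.
  by move=> av; apply: spansZ; rewrite invr_eq0 Z.
have anorm v : 0 < area v y -> 0 < area ((C_form v (to_C R y.2))^-1 *: v) y.
  by move=> av; rewrite areaZ mulr_gt0 // abs2_gt0 invr_eq0 Z.
have pnorm v z : 0 < area v y -> spans v z -> Omega z ->
    period_vector ((C_form v (to_C R y.2))^-1 *: v).
  by move=> av sv Oz; apply/(period_vector_spans (snorm _ _ av sv)).
have [u [cu u0 u1 u2 up]] := period_path iso (pnorm _ _ aw sw Ox)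
  (pnorm _ _ aw' sw' Ox') (norm1 _ aw) (norm1 _ aw') (anorm _ aw) (anorm _ aw').
have un0 s : u s != 0.
  apply: contra_eq_neq (u2 s) => ->.
  by rewrite C_formE pairing0l eq_sym oner_neq0.
have cpt := @proj_pt_continuous _ _ u un0 (vcontinuousP cu).
pose C := [set proj_pt (un0 s) | s in `[0, 1]].
have conC : connected C.
  apply: connected_continuous_connected; first exact: segment_connected.
  exact: continuous_subspaceT.
have CO : C `<=` @Omega R.
  move=> _ [s /= s01 <-]; apply/(period_vector_spans (spans_pt (un0 s))).
  by apply: up; rewrite in_itv in s01.
have xE : proj_pt (un0 0) = x.
  apply: (spans_inj (spans_pt (un0 0))); rewrite u0; exact: snorm.
have x'E : proj_pt (un0 1) = x'.
  apply: (spans_inj (spans_pt (un0 1))); rewrite u1; exact: snorm.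
have Cx : C x by exists 0 => //=; rewrite in_itv /= lexx ler01.
have Cx' : C x' by exists 1 => //=; rewrite in_itv /= lexx ler01.
have xx' : connected_component (@Omega R) x x'.
  exact: (connected_component_max Cx CO conC).
rewrite OpE; apply: connected_component_trans xx'.
by rewrite -OpE.
Qed.

Lemma component_sub_Omega Op : is_component (@Omega R) Op -> Op `<=` @Omega R.
Proof. by move=> [x0 _ ->]; exact: connected_component_sub. Qed.

(** A homogeneous set is saturated for collinearity, so an open one descends to
    the quotient. *)
Lemma open_cone (C : set 'cV[R[i]]_20) : open C ->
  (forall (c : R[i]) w, c != 0 -> C w -> C (c *: w)) ->
  open [set x : proj_space R | C (spanning x)].
Proof.
move=> oC homC; rewrite /open /= /quotient_open.
rewrite (_ : _ @^-1` _ = (set_val : @nonzero_vectors R -> _) @^-1` C).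
  by move/continuousP: (@initial_continuous (@nonzero_vectors R) _ set_val); apply.
apply/seteqP; split=> v /=.
  have [c c0 e] := spans_pi v; move=> Cv.
  by have : C (\val v) by rewrite e; exact: homC.
move=> Cv; have [c c0 e] := spans_pi v.
have -> : spanning (\pi_{eq_quot (@collinear R)} v) = c^-1 *: \val v.
  by rewrite e scalerA mulVf // scale1r.
by apply: homC => //; rewrite invr_eq0.
Qed.

(** The neighborhood is open in the quadric: the area keeps the sign that
    characterizes the component, and [rho] is upper semicontinuous. *)
Lemma calV_p_locally_open Op V x0 : is_component (@Omega R) Op ->
  primitive_isotropic_rank2 V -> calV_p Op V x0 ->
  exists O : set (proj_space R), [/\ open O, O x0 &
    forall x, O x -> pairing (spanning x) (spanning x) = 0 -> calV_p Op V x].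
Proof.
move=> hOp Vp cx0; have OpO := component_sub_Omega hOp; have [_ _ _ Viso] := Vp.
have Opx0 : Op x0 by case: cx0.
have sw0 := spans_self x0; set w0 := spanning x0 in sw0.
have pw0 : period_vector w0 by apply/(period_vector_spans sw0)/OpO.
have [y [yb y0]] := oriented_basis Vp pw0; have [y1 y2] := Zbasis_mem yb.
move: cx0; rewrite (calV_pE _ sw0 yb y0) gt_max => -[_ /andP[u_rho u_s]].
have t0 := Im_vratio_gt0 y0.
(* [r] leaves room for [rho] to increase and for [u2] to decrease. *)
have [r r1 r2] : exists2 r, rho (vratio w0 y) < r & r < herm w0 / (4 * area w0 y).
  exists ((rho (vratio w0 y) + herm w0 / (4 * area w0 y)) / 2).
    by rewrite midf_lt.
  by rewrite midf_lt.
have r0 : 0 < r by apply: lt_trans r1; exact: (lt_le_trans t0 (Im_le_rho t0)).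
have [e e0 rho_e] := rho_usc t0 r1.
pose Z1 (w : 'cV[R[i]]_20) := C_form w (to_C R y.1).
pose Z2 (w : 'cV[R[i]]_20) := C_form w (to_C R y.2).
pose f1 (w : 'cV[R[i]]_20) := area w y.
pose f2 w := e ^+ 2 * abs2 (Z2 w) - abs2 (Z1 w - vratio w0 y * Z2 w).
pose f3 w := herm w - r * (4 * area w y).
pose f4 w := herm w - 2 / Num.sqrt 3 * (4 * area w y).
pose C : set 'cV[R[i]]_20 := [set w | 0 < f1 w] `&` [set w | 0 < f2 w] `&`
  ([set w | 0 < f3 w] `&` [set w | 0 < f4 w]).
have cid := @vcontinuous_id R.
have cZ (a : lattice) := ccontinuous_C_form a cid.
have c1 : continuous f1 by exact: (continuous_area cid).
have ch : continuous (fun w : 'cV[R[i]]_20 => herm w) by exact: (continuous_herm cid).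
have c3 c : continuous (fun w : 'cV[R[i]]_20 => herm w - c * (4 * area w y)).
  exact: (continuous_subr ch (continuous_mull (c := c) (continuous_mull (c := 4) c1))).
have c2 : continuous f2.
  apply: (continuous_subr (continuous_mull (c := e ^+ 2) (continuous_abs2 (cZ y.2)))).
  apply: (@continuous_abs2 _ _ (fun w => Z1 w - vratio w0 y * Z2 w)).
  rewrite (_ : (fun w => _) = fun w => Z1 w + (- vratio w0 y) * Z2 w).
    apply: ccontinuousD; first exact: cZ.
    by apply: ccontinuousM; [exact: ccontinuous_cst | exact: cZ].
  by apply/funext => v; rewrite mulNr.
have op (f : 'cV[R[i]]_20 -> R) : continuous f -> open [set w | 0 < f w].
  by move=> cf; apply: (open_comp (f := f) (D := [set t | 0 < t])) => [w _|];
     [exact: cf | exact: open_gt].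
have oC : open C.
  apply: openI; apply: openI; apply: op.
  - exact: c1.
  - exact: c2.
  - exact: c3.
  - exact: c3.
have homC (c : R[i]) w : c != 0 -> C w -> C (c *: w).
  move=> c0; have ac : 0 < abs2 c by rewrite abs2_gt0.
  have ZE a : C_form (c *: w) (to_C R a) = c * C_form w (to_C R a).
    by rewrite !C_formE pairingZl.
  have h1 : f1 (c *: w) = abs2 c * f1 w by rewrite /f1 areaZ.
  have h2 : f2 (c *: w) = abs2 c * f2 w.
    rewrite /f2 /Z1 /Z2 !ZE (mulrCA _ c) -mulrBr !abs2M; ring.
  have h3 : f3 (c *: w) = abs2 c * f3 w by rewrite /f3 areaZ hermZ; ring.
  have h4 : f4 (c *: w) = abs2 c * f4 w by rewrite /f4 areaZ hermZ; ring.
  by move=> [[C1 C2] [C3 C4]]; split; split; rewrite /= ?h1 ?h2 ?h3 ?h4 mulr_gt0.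
exists [set x | C (spanning x)]; split; first exact: open_cone.
  have a0 : 0 < 4 * area w0 y by rewrite mulr_gt0.
  split; split=> /=.
  - exact: y0.
  - have Z20 : Z2 w0 != 0 by apply: area_neq0; exact: lt0r_neq0 y0.
    rewrite /f2 /vratio -/(Z1 w0) -/(Z2 w0) divfK // subrr.
    rewrite /abs2 /= expr0n /= addr0 subr0 mulr_gt0 ?exprn_gt0 //.
    by rewrite -/(abs2 (Z2 w0)) abs2_gt0.
  - by rewrite /f3 subr_gt0 -ltr_pdivlMr.
  - by rewrite /f4 subr_gt0 -ltr_pdivlMr.
move=> x [[/= C1 C2] [C3 C4]] xx; set w := spanning x in C1 C2 C3 C4 xx.
have a0 : 0 < 4 * area w y by rewrite mulr_gt0.
have pw : period_vector w.
  apply/period_vectorP; split=> //; apply: lt_trans (_ : r * (4 * area w y) < _).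
    by rewrite mulr_gt0.
  by rewrite -subr_gt0.
have sw : spans w x by exact: spans_self.
have Ox : Omega x by apply/(period_vector_spans sw).
have Opx : Op x.
  by apply: (same_component hOp _ sw0 sw Opx0 Ox y0 C1); rewrite !Viso.
rewrite (calV_pE _ sw yb C1); split; first exact: Opx.
rewrite gt_max; apply/andP; split; last by rewrite ltr_pdivlMr // -subr_gt0.
apply: (@le_lt_trans _ _ r); last by rewrite ltr_pdivlMr // -subr_gt0.
have Z20 : Z2 w != 0 by apply: area_neq0; exact: lt0r_neq0 C1.
apply: rho_e; first exact: Im_vratio_gt0.
have -> : vratio w y - vratio w0 y = (Z1 w - vratio w0 y * Z2 w) / Z2 w.
  by rewrite [vratio w y]/vratio -/(Z1 w) -/(Z2 w); field.
have Z2gt : 0 < abs2 (Z2 w) by rewrite abs2_gt0.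
rewrite -(ltr_pM2r Z2gt) -abs2M divfK //.
by rewrite -subr_gt0.
Qed.

End Components.

(** * The torus coordinate and the nilpotent endomorphism *)

Section Torus.
Variable R : realType.

Lemma abs_torus_coord (z : R[i]) :
  `|torus_coord z| = (expR (- (2 * pi * complex.Im z)))%:C.
Proof.
case: z => a b; rewrite /torus_coord /cexp.
rewrite (_ : 2 * pi%:C * 'i * (a +i* b) = (- (2 * pi * b)) +i* (2 * pi * a)); last first.
  by apply/eqP; rewrite eq_complex /=; apply/andP; split; apply/eqP; ring.
rewrite normc_def; congr (_ %:C); rewrite /=.
set r := expR _; set t := 2 * pi * a.
have -> : (r * cos t - 0 * sin t) ^+ 2 + (r * sin t + 0 * cos t) ^+ 2 =
    r ^+ 2 * (cos t ^+ 2 + sin t ^+ 2) by ring.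
by rewrite cos2Dsin2 mulr1 sqrtr_sqr ger0_norm // expR_ge0.
Qed.

Lemma torus_coord_surj (s : R[i]) : s != 0 -> exists z, s = torus_coord z.
Proof.
move=> s0; pose r := complex.Re `|s|.
have rE : `|s| = r%:C by rewrite RRe_real // normr_real.
have r0 : 0 < r by rewrite -ltcR -rE normr_gt0.
pose c := complex.Re s / r; pose d := complex.Im s / r.
have cd : c ^+ 2 + d ^+ 2 = 1.
  have : abs2 s = r ^+ 2.
    by apply: complexI; rewrite /abs2 add_Re2_Im2 rE rmorphXn.
  rewrite /abs2 => e; rewrite /c /d !expr_div_n -mulrDl e divff //.
  by rewrite expf_neq0 // gt_eqF.
have c1 : -1 <= c <= 1.
  have := sqr_ge0 d; move: c d cd => u v uv v0; apply/andP; split; nra.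
have [t [ct st]] : exists t, cos t = c /\ sin t = d.
  have sE : Num.sqrt (1 - c ^+ 2) = `|d| by rewrite -cd addrC addKr sqrtr_sqr.
  have [d0|d0] := leP 0 d.
    by exists (acos c); rewrite acosK ?in_itv //= sin_acos // sE ger0_norm.
  exists (- acos c); rewrite cosN sinN acosK ?in_itv //= sin_acos // sE.
  by rewrite ltr0_norm // opprK.
have pi0 : 2 * pi != 0 :> R by rewrite mulf_neq0 // gt_eqF // pi_gt0.
exists ((t / (2 * pi)) +i* (- ln r / (2 * pi))).
rewrite /torus_coord /cexp.
rewrite (_ : 2 * pi%:C * 'i * _ = ln r +i* t); last first.
  have e1 : 2 * pi * (t / (2 * pi)) = t by rewrite mulrCA divff ?mulr1.
  have e2 : 2 * pi * (- ln r / (2 * pi)) = - ln r by rewrite mulrCA divff ?mulr1.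
  apply/eqP; rewrite eq_complex /=; apply/andP; split; apply/eqP.
    by transitivity (- (2 * pi * (- ln r / (2 * pi)))); [ring | rewrite e2 opprK].
  by transitivity (2 * pi * (t / (2 * pi))); [ring | rewrite e1].
rewrite [complex.Re _]/= [complex.Im _]/= lnK ?posrE // ct st /c /d.
apply/eqP; rewrite eq_complex ReZ ImZ /= !mul0r subr0 addr0.
by rewrite !(mulrC r) !divfK ?lt0r_neq0 ?eqxx.
Qed.

End Torus.

Section Nilpotent.
Variables (R : realType) (Op : set (proj_space R)) (V : set lattice) (N : 'M[int]_20).
Hypotheses (hOp : is_component (@Omega R) Op) (Vp : primitive_isotropic_rank2 V)
  (hN : is_N Op V N).
Implicit Types (w : 'cV[R[i]]_20) (x : proj_space R) (z : R[i]).

Let skewN (a b : lattice) : lat_form (N *m a) b = - lat_form a (N *m b).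
Proof. by case: hN => _ _ sk _ _; apply/eqP; rewrite -addr_eq0 sk. Qed.

Let N_in (a : lattice) : V (N *m a).
Proof. by case: hN => _ _ _ <- _; exists a. Qed.

Let Viso (a b : lattice) : V a -> V b -> lat_form a b = 0.
Proof. by case: Vp => _ _ _; apply. Qed.

Lemma matrix_ext (A B : 'M[int]_20) :
  (forall a b : lattice, (a^T *m A *m b) 0 0 = (a^T *m B *m b) 0 0) -> A = B.
Proof.
move=> AB; apply/matrixP => i j.
have E (M : 'M[int]_20) : M i j =
    ((delta_mx i 0 : lattice)^T *m M *m (delta_mx j 0 : lattice)) 0 0.
  by rewrite trmx_delta -rowE -colE !mxE.
by rewrite [LHS]E [RHS]E.
Qed.

(** The image of [N ^+ 2] is orthogonal to the lattice, in particular
    isotropic and orthogonal to a period vector, hence zero. *)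
Lemma N_sqr : N *m N = 0.
Proof.
suff NN (a : lattice) : N *m (N *m a) = 0.
  by apply: matrix_ext => a b; rewrite -!mulmxA NN mulmx0 mul0mx mulmx0.
set u := N *m _; have ub (b : lattice) : lat_form u b = 0.
  by rewrite /u skewN Viso ?oppr0.
have [x0 Ox0 _] := hOp; have pw : period_vector (spanning x0) by apply/OmegaP.
apply/eqP; apply: contraT => u0.
have := abs2_C_form_gt0 pw (ub u) u0.
have uL : u^T *m L_gram = 0.
  apply/rowP => j; rewrite [RHS]mxE -[RHS](ub (delta_mx j 0)) /lat_form.
  by rewrite -colE !mxE.
rewrite C_formE pairingC.
have -> : pairing (to_C R u) (spanning x0) = 0.
  with_strategy transparent [pairing] rewrite /pairing.
  by rewrite matrix.map_trmx -map_mxM uL map_mx0 mul0mx mxE.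
by rewrite /abs2 expr0n addr0 ltxx.
Qed.

Let Nv w := to_C R N *m w.

Lemma N_Nv w : Nv (Nv w) = 0.
Proof. by rewrite /Nv mulmxA -map_mxM N_sqr map_mx0 mul0mx. Qed.

Lemma NvD w w' : Nv (w + w') = Nv w + Nv w'.
Proof. exact: mulmxDr. Qed.

Lemma NvZ z w : Nv (z *: w) = z *: Nv w.
Proof. by rewrite /Nv scalemxAr. Qed.

Lemma conj_Nv w : conj_vec (Nv w) = Nv (conj_vec w).
Proof. exact: conj_vec_mul. Qed.

(** Skewness is a matrix identity, so it holds over the complex numbers. *)
Lemma Nv_skew w w' : pairing (Nv w) w' = - pairing w (Nv w').
Proof.
have NL : N^T *m L_gram = - (L_gram *m N).
  apply: matrix_ext => a b; have := skewN a b; rewrite /lat_form trmx_mul !mulmxA => ->.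
  by rewrite mulmxN mulNmx !mulmxA [RHS]mxE.
with_strategy transparent [pairing] rewrite /pairing /Nv.
rewrite trmx_mul matrix.map_trmx -!mulmxA (mulmxA (map_mx _ _)) -map_mxM NL.
by rewrite map_mxN mulNmx mulmxN mxE map_mxM !mulmxA.
Qed.

Lemma pairing_Nv_Nv w w' : pairing (Nv w) (Nv w') = 0.
Proof. by rewrite Nv_skew N_Nv pairing0r oppr0. Qed.

Lemma pairing_Nv w : pairing w (Nv w) = 0.
Proof.
have := Nv_skew w w; rewrite pairingC => /eqP; rewrite -addr_eq0 -mulr2n.
by rewrite mulrn_eq0 /= => /eqP.
Qed.

Definition expv z w := w + z *: Nv w.

(** As [N ^+ 2 = 0], the exponential series stops after the linear term. *)
Lemma expN_mul z w : expN N z *m w = expv z w.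
Proof.
rewrite /expN 2!big_ord_recl big1 => [|k _]; last first.
  have NN : to_C R N * to_C R N = 0 by rewrite -[LHS](map_mxM intr) N_sqr map_mx0.
  by rewrite [to_C R N ^+ _](_ : _ = 0) ?scaler0 //= 2!exprS mulrA NN mul0r.
rewrite addr0 /= expr0 expr1 !divr1 expr0 scale1r expr1 mulmxDl mul1mx.
by rewrite -scalemxAl.
Qed.

Lemma expvD z z' w : expv z (expv z' w) = expv (z + z') w.
Proof.
by rewrite /expv NvD NvZ N_Nv scaler0 addr0 scalerDl addrA addrAC.
Qed.

Lemma expv0 w : expv 0 w = w.
Proof. by rewrite /expv scale0r addr0. Qed.

Lemma expv_neq0 z w : w != 0 -> expv z w != 0.
Proof.
apply: contra => /eqP e; rewrite -(expv0 w) -(addNr z) -expvD e.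
by rewrite /expv /Nv mulmx0 scaler0 addr0.
Qed.

Lemma pairing_expv z w : pairing (expv z w) (expv z w) = pairing w w.
Proof.
rewrite /expv !pairingE pairing_Nv_Nv pairing_Nv Nv_skew pairing_Nv.
by rewrite !mulr0 oppr0 mulr0 !addr0.
Qed.

Lemma C_form_expv z w (a : lattice) : V a ->
  C_form (expv z w) (to_C R a) = C_form w (to_C R a).
Proof.
case: hN => _ _ _ <- _ [b _ <-]; rewrite !C_formE /expv !pairingE.
by rewrite /to_C map_mxM pairing_Nv_Nv mulr0 addr0.
Qed.

(** Half the rate of growth of [herm (expv z w)] in [Im z]; the choice of the sign
    of [N] makes it positive on the component. *)
Definition slope w : R := complex.Re ('i * pairing (Nv w) (conj_vec w)).

Lemma pairing_Nv_conj w : pairing (Nv w) (conj_vec w) = - 'i * (slope w)%:C.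
Proof.
rewrite /slope; set c := pairing _ _.
have : c^* = - c.
  rewrite /c (map_pairing Num.conj) -/(conj_vec _) -/(conj_vec (conj_vec w)).
  have -> : conj_vec (conj_vec w) = w.
    by apply/colP => k; rewrite !mxE conjCK.
  by rewrite conj_Nv Nv_skew pairingC opprK.
case: c => a b [e]; apply/eqP; rewrite eq_complex /=; apply/andP; split; apply/eqP.
  by lra.
by lra.
Qed.

Lemma herm_expv z w : herm (expv z w) = herm w + 2 * complex.Im z * slope w.
Proof.
apply: complexI; rewrite -pairing_conj /expv conj_vecD conj_vecZ conj_Nv !pairingE.
rewrite pairing_Nv_Nv pairing_conj pairing_Nv_conj (pairingC w) Nv_skew.
rewrite (pairingC (conj_vec w)) pairing_Nv_conj.
case: z => a b.
by apply/eqP; rewrite eq_complex /=; apply/andP; split; apply/eqP; ring.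
Qed.

Lemma slope_expv z w : slope (expv z w) = slope w.
Proof.
rewrite /slope /expv NvD NvZ N_Nv scaler0 addr0 conj_vecD conj_vecZ conj_Nv.
by rewrite pairingDr pairingZr pairing_Nv_Nv mulr0 addr0.
Qed.

Lemma slope_gt0 x : Op x -> 0 < slope (spanning x).
Proof.
case: hN => _ _ _ _ /[apply] /=; rewrite C_formE -/(Nv _) pairing_Nv_conj.
rewrite mulrA mulrN -expr2 sqr_i opprK mul1r.
by rewrite ltcR.
Qed.

End Nilpotent.

(** * The torus bundle *)

Section Bundle.
Variables (R : realType) (Op : set (proj_space R)) (V : set lattice) (N : 'M[int]_20).
Hypotheses (hOp : is_component (@Omega R) Op) (Vp : primitive_isotropic_rank2 V)
  (hN : is_N Op V N).
Implicit Types (w : 'cV[R[i]]_20) (x : proj_space R) (z : R[i]).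

Definition exp_act z x := proj_act (expN N z) x.

Lemma spans_exp_act z x w : spans w x -> spans (expv N z w) (exp_act z x).
Proof.
move=> sw; rewrite -(expN_mul hOp Vp hN); apply: spans_act => //.
by rewrite (expN_mul hOp Vp hN) (expv_neq0 hOp Vp hN) // (spans_neq0 sw).
Qed.

Lemma exp_actD z z' x : exp_act z (exp_act z' x) = exp_act (z + z') x.
Proof.
have sx := spans_self x.
apply: (spans_inj (spans_exp_act z (spans_exp_act z' sx))).
by rewrite (expvD hOp Vp hN); exact: spans_exp_act.
Qed.

Lemma exp_act0 x : exp_act 0 x = x.
Proof.
apply: (spans_inj (spans_exp_act 0 (spans_self x))).
by rewrite expv0; exact: spans_self.
Qed.

Lemma OmegaVP x : OmegaV Op N x <-> exists z x0, Op x0 /\ x = exp_act z x0.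
Proof.
split=> [[_ [z _ <-] [x0 Ox0 <-]]|[z [x0 [Ox0 ->]]]]; first by exists z, x0.
by exists (expN N z); [exists z | exists x0].
Qed.

Lemma OmegaV_exp_act z x : OmegaV Op N x -> OmegaV Op N (exp_act z x).
Proof.
move=> /OmegaVP[z0 [x0 [Ox0 ->]]]; apply/OmegaVP.
by exists (z + z0), x0; rewrite exp_actD.
Qed.

Lemma OmegaV_isotropic x : OmegaV Op N x -> pairing (spanning x) (spanning x) = 0.
Proof.
move=> /OmegaVP[z [x0 [Ox0 ->]]].
have /OmegaP/period_vectorP[p0 _] := component_sub_Omega hOp Ox0.
have [c c0 e] := spans_exp_act z (spans_self x0).
have := pairing_expv hOp Vp hN z (spanning x0); rewrite e p0 !pairingE => /eqP.
by rewrite !mulf_eq0 (negbTE c0) /= => /eqP.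
Qed.

(** Along an orbit of [exp (z N)] the periods of V, hence [tau], are constant
    while [u2] is an affine increasing function of [Im z]; moving far enough
    therefore enters the neighborhood, once and for all. *)
Lemma calV_p_threshold x : OmegaV Op N x ->
  exists K : R, forall z, calV_p Op V (exp_act z x) <-> K < complex.Im z.
Proof.
move=> /OmegaVP[z0 [x0 [Ox0 xE]]].
have [_ _ _ Viso] := Vp.
have sx0 := spans_self x0; set w0 := spanning x0 in sx0.
have pw0 : period_vector w0 by apply/(period_vector_spans sx0)/(component_sub_Omega hOp).
have [y [yb y0]] := oriented_basis Vp pw0; have [y1 y2] := Zbasis_mem yb.
pose w := expv N z0 w0.
have sw : spans w x by rewrite xE; exact: spans_exp_act.
have ww : pairing w w = 0.
  by rewrite /w (pairing_expv hOp Vp hN); case/period_vectorP: pw0.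
have aE z v : area (expv N z v) y = area v y.
  by rewrite !area_C_form !(C_form_expv hOp Vp hN).
have rE z v : vratio (expv N z v) y = vratio v y.
  by rewrite /vratio !(C_form_expv hOp Vp hN).
have s0 : 0 < slope N w by rewrite /w (slope_expv hOp Vp hN); exact: (slope_gt0 hN).
set m := Num.max (rho (vratio w0 y)) (2 / Num.sqrt 3).
have m0 : 0 < m by rewrite lt_max divr_gt0 ?orbT // sqrtr_gt0.
exists ((m * (4 * area w0 y) - herm w) / (2 * slope N w)) => z.
have sz : spans (expv N z w) (exp_act z x) by exact: spans_exp_act.
have az : area (expv N z w) y = area w0 y by rewrite aE /w aE.
have rz : vratio (expv N z w) y = vratio w0 y by rewrite rE /w rE.
have az0 : 0 < area (expv N z w) y by rewrite az.
rewrite (calV_pE _ sz yb az0) rz az (herm_expv hOp Vp hN) -/m.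
have a4 : 0 < 4 * area w0 y by rewrite mulr_gt0.
have s2 : 0 < 2 * slope N w by rewrite mulr_gt0.
rewrite (ltr_pdivlMr _ _ a4) (ltr_pdivrMr _ _ s2) ltrBlDl.
rewrite (_ : complex.Im z * (2 * slope N w) = 2 * complex.Im z * slope N w); last by ring.
split=> [[_ h]|h]; [exact: h | split; last exact: h].
have Oz : Omega (exp_act z x).
  apply/(period_vector_spans sz)/period_vectorP; rewrite (pairing_expv hOp Vp hN).
  split; first exact: ww.
  by rewrite (herm_expv hOp Vp hN); apply: lt_trans h; rewrite mulr_gt0.
apply: (same_component hOp _ sx0 sz Ox0 Oz y0 az0).
by split; apply: Viso.
Qed.

(** U(N)_Z acts along the orbits without changing [Im z]. *)
Lemma calV_p_exp_int (n : int) x : OmegaV Op N x ->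
  calV_p Op V (exp_act n%:~R x) <-> calV_p Op V x.
Proof.
move=> /calV_p_threshold[K HK]; rewrite HK -[x in X in _ <-> X]exp_act0 HK.
by rewrite intrC.
Qed.

Lemma mx_orbit_UZP x x' : mx_orbit (UZ N) x x' <-> exists n : int, x' = exp_act n%:~R x.
Proof.
split=> [[_ [n _ <-] <-]|[n ->]]; first by exists n.
by exists (expN N n%:~R) => //; exists n.
Qed.

Lemma mx_orbit_UCP x x' : mx_orbit (UC N) x x' <-> exists z, x' = exp_act z x.
Proof.
split=> [[_ [n _ <-] <-]|[n ->]]; first by exists n.
by exists (expN N n) => //; exists n.
Qed.

Lemma mx_orbit_UC z x : mx_orbit (UC N) (exp_act z x) = mx_orbit (UC N) x.
Proof.
apply/seteqP; split=> x' /mx_orbit_UCP[z' ->]; apply/mx_orbit_UCP.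
  by exists (z' + z); rewrite exp_actD.
by exists (z' - z); rewrite exp_actD subrK.
Qed.

Local Notation D := (OmegaV Op N).

Lemma orbit_class_UZ (x x' : D) : orbit_class (UZ N) x = orbit_class (UZ N) x' ->
  exists n : int, \val x' = exp_act n%:~R (\val x).
Proof.
move=> /eqmodP/asboolP e; apply/mx_orbit_UZP; rewrite e; apply/mx_orbit_UZP.
by exists 0; rewrite mulr0z exp_act0.
Qed.

Let W : set (total_space Op N) := orbit_image (UZ N) D (calV_p Op V).

Lemma orbit_imageP (x : D) : W (orbit_class (UZ N) x) <-> calV_p Op V (\val x).
Proof.
split=> [[x' /= cx' /orbit_class_UZ[n ->]]|cx]; last by exists x.
apply/calV_p_exp_int => //; exact: set_valP.
Qed.

(** Since the neighborhood is stable under U(N)_Z, the preimage of its image is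
    itself, which is open in the quadric. *)
Lemma open_orbit_image : open W.
Proof.
pose O := \bigcup_(O in [set O : set (proj_space R) | open O /\
  forall x, O x -> pairing (spanning x) (spanning x) = 0 -> calV_p Op V x]) O.
have oO : open O by apply: bigcup_open => U [].
rewrite /open /= /quotient_open.
rewrite (_ : _ @^-1` _ = (set_val : D -> _) @^-1` O).
  by move/continuousP: (@initial_continuous D _ set_val); apply.
apply/seteqP; split=> x /=.
  move=> /orbit_imageP/(calV_p_locally_open hOp Vp) -[U [oU Ux sU]].
  by exists U.
move=> [U [_ sU] Ux]; apply/orbit_imageP; apply: sU => //.
by apply: OmegaV_isotropic; exact: set_valP.
Qed.

Lemma bundle_proj_class (x x' : D) z : \val x' = exp_act z (\val x) ->
  bundle_proj (orbit_class (UZ N) x') = orbit_class (UC N) x.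
Proof.
move=> e; rewrite /bundle_proj; set r := orbit_repr _.
have /orbit_class_UZ[n en] : orbit_class (UZ N) r = orbit_class (UZ N) x'.
  by rewrite /orbit_class /r /orbit_repr reprK.
apply/eqmodP/asboolP; rewrite -(mx_orbit_UC z (\val x)) -e en.
by rewrite mx_orbit_UC.
Qed.

(** The condition [K < Im z] of the threshold reads [|s| < exp (- 2 pi K)] on the
    torus coordinate: with its cusp, the intersection is a disc. *)
Lemma open_nbhs_with_cusp (b : base_space Op N) (t : total_space Op N) :
  fiber b t -> open_nbhs 0 (with_cusp t (W `&` fiber b)).
Proof.
rewrite /fiber /= => tb; set x := orbit_repr t.
have xD : D (\val x) by exact: set_valP.
have [K HK] := calV_p_threshold xD.
have actE z : exists2 x' : D, \val x' = exp_act z (\val x) &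
    bundle_act z t = orbit_class (UZ N) x'.
  exists (insubd x (exp_act z (\val x))) => //.
  by rewrite val_insubd (mem_set (OmegaV_exp_act z xD)).
have WE z : (W `&` fiber b) (bundle_act z t) <-> K < complex.Im z.
  have [x' ex' ->] := actE z; rewrite -HK -ex'; split=> [[/orbit_imageP //]|cx'].
  split; first exact/orbit_imageP.
  by rewrite /fiber /= (bundle_proj_class ex') -tb.
have -> : with_cusp t (W `&` fiber b) =
    [set s : R[i] | `|0 - s| < (expR (- (2 * pi * K)))%:C].
  apply/seteqP; split=> s.
    case=> [->|[z -> /WE Kz]] /=; first by rewrite subr0 normr0 ltcR expR_gt0.
    rewrite sub0r normrN abs_torus_coord ltcR ltr_expR ltrN2 ltr_pM2l //.
    by rewrite mulr_gt0 // pi_gt0.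
  rewrite /= sub0r normrN => sK; have [->|s0] := eqVneq s 0; first by left.
  right; have [z zE] := torus_coord_surj s0; exists z => //; apply/WE.
  move: sK; rewrite zE abs_torus_coord ltcR ltr_expR ltrN2 ltr_pM2l //.
  by rewrite mulr_gt0 // pi_gt0.
split; last by rewrite /= subr0 normr0 ltcR expR_gt0.
have : 0 < (expR (- (2 * pi * K)))%:C :> R[i] by rewrite ltcR expR_gt0.
set e := (expR _)%:C => e0.
have := @ball_open _ R[i] 0 e.
rewrite -ball_normE; apply.
Qed.

End Bundle.

Local Close Scope quotient_scope.
Local Close Scope complex_scope.

Theorem theorem4p3 (R : realType) (Omega_p : set (proj_space R)) (V : set lattice)
    (hOmega : is_component (@Omega R) Omega_p)
    (hV : primitive_isotropic_rank2 V) :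
  [/\ forall g, P_p Omega_p V g ->
        lat_act g @` calV_p Omega_p V = calV_p Omega_p V,
      forall N, is_N Omega_p V N ->
        let W : set (total_space Omega_p N) :=
          orbit_image (UZ N) (OmegaV Omega_p N) (calV_p Omega_p V) in
        open W /\
        forall (b : base_space Omega_p N) (t : total_space Omega_p N),
          fiber b t -> open_nbhs 0 (with_cusp t (W `&` fiber b))
    & forall (x1 x2 : proj_space R) (g : 'M[int]_20),
        calV_p Omega_p V x1 -> calV_p Omega_p V x2 ->
        Gamma_p Omega_p g -> lat_act g x1 = x2 -> P_p Omega_p V g].
Proof.
have subO := component_sub_Omega hOmega.
split.
- move=> g [sg [_ gO]]; apply/seteqP; split=> [_ [x cx <-]|x' cx'].
    have Ox : Omega_p x by case: cx.
    have Ogx : Omega_p (lat_act g x) by rewrite -gO; exists x.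
    have [_ calV_act] := calV_p_act subO hV sg Ox Ogx; exact: calV_act.
  have [x Ox xE] : (lat_act g @` Omega_p) x' by rewrite gO; case: cx'.
  have Ogx : Omega_p (lat_act g x) by rewrite -gO; exists x.
  exists x; last exact: xE.
  have [act_calV _] := calV_p_act subO hV sg Ox Ogx.
  by apply: act_calV; rewrite xE; exact: cx'.
- move=> N hN W; split; first exact: open_orbit_image.
  by move=> b t bt; exact: open_nbhs_with_cusp.
- move=> x1 x2 g c1 c2 Gg gx; split; last exact: Gg.
  rewrite -gx in c2; apply: (stabilizer_of_short_points subO hV _ c1 c2).
  by case: Gg.
Qed.
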